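(* Suppose $X$ has transition densities $(p_t)_{t\ge1}$ with respect to a measure $\mu$ on $(\mathbb{X},\mathcal{B})$; that is, for each $t=1,2,\dots$, $p_t:\mathbb{X}\times\mathbb{X}\to\mathbb{R}_+$ is a Borel measurable function such that $$\mathbb{P}_x(X_t\in A)=\int_A p_t(x,y)\,\mu(dy),\qquad\forall x\in\mathbb{X},\ A\in\mathcal{B}.$$ For each $i\in\{1,2\}$, assume $f_i\le h_i\le g_i$ on $\mathbb{X}$ and that $(\delta_i(t)g_i(X_t^x))_{t\ge0}$ is a supermartingale for all $x\in\mathbb{X}$. Then there exists a sharp inter-personal equilibrium, i.e. $\widehat{\mathcal{E}}\ne\emptyset$.
   Context: Setting (nonzero-sum Dynkin game). $\mathbb{Z}_+=\{0,1,2,\dots\}$, $\mathbb{N}=\{1,2,\dots\}$. $X=(X_t)_{t\in\mathbb{Z}_+}$ is a time-homogeneous strong Markov process with values in a Polish space $\mathbb{X}$ with Borel $\sigma$-algebra $\mathcal{B}$, on the path space $\Omega$ of functions $\mathbb{Z}_+\to\mathbb{X}$; $(\mathcal{F}_t)$ is the filtration generated by $X$, $\mathcal{T}$ is the set of $(\mathcal{F}_t)$-stopping times (allowed to take the value $+\infty$), $X^x$ is the process $X$ with $X_0=x$, $\mathbb{P}_x$ is its law, and $\mathbb{E}_x$ the corresponding expectation. For $i\in\{1,2\}$: the discount function $\delta_i:\mathbb{Z}_+\to[0,1]$ is strictly decreasing with $\delta_i(0)=1$ and $\delta_i(s)\delta_i(t)\le\delta_i(s+t)$ for all $s,t\in\mathbb{Z}_+$;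 $f_i,g_i,h_i:\mathbb{X}\to\mathbb{R}_+=[0,\infty)$ are Borel measurable with $\mathbb{E}_x\big[\sup_{t\in\mathbb{N}}\delta_i(t)(f_i(X_t)+g_i(X_t)+h_i(X_t))\big]<\infty$ for all $x\in\mathbb{X}$. For $\tau,\sigma\in\mathcal{T}$, $$F_i(\tau,\sigma):=\delta_i(\tau)f_i(X_\tau)1_{\{\tau<\sigma\}}+\delta_i(\sigma)g_i(X_\sigma)1_{\{\tau>\sigma\}}+\delta_i(\tau)h_i(X_\tau)1_{\{\tau=\sigma\}},$$ with $F_i(\tau,\sigma):=\limsup_{t\to\infty}\delta_i(t)h_i(X_t)$ on $\{\tau=\sigma=+\infty\}$, and $J_i(x,\tau,\sigma):=\mathbb{E}_x[F_i(\tau,\sigma)]$. Here $\tau$ is Player $i$'s stopping time and $\sigma$ the other player's. Stopping policies are sets $S\in\mathcal{B}$. Put $\rho_S:=\inf\{t\ge0:X_t\in S\}$ and $\rho_S^+:=\inf\{t>0:X_t\in S\}$ ($\inf\emptyset=\infty$). Equilibria. For $S,T\in\mathcal{B}$ let $$\Theta_i^T(S):=\{x\in S: J_i(x,0,\rho_T)\ge J_i(x,\rho_S^+,\rho_T)\}\cup\{x\notin S: J_i(x,0,\rho_T)>J_i(x,\rho_S^+,\rho_T)\}.$$ $S$ is an intra-personal equilibrium of Player $i$ with respect to $T$ if $\Theta_i^T(S)=S$; $\mathcal{E}_i^T$ is the set of these. For $S\in\mathcal{E}_i^T$ let $U_i^T(x,S):=\max\{J_i(x,0,\rho_T),J_i(x,\rho_S^+,\rho_T)\}$.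 $S\in\mathcal{E}_i^T$ is optimal if $U_i^T(x,S)\ge U_i^T(x,R)$ for all $R\in\mathcal{E}_i^T$ and all $x\in\mathbb{X}$; $\widehat{\mathcal{E}}_i^T$ is the set of optimal ones. $(S,T)\in\mathcal{B}\times\mathcal{B}$ is a sharp inter-personal equilibrium if $S\in\widehat{\mathcal{E}}_1^T$ and $T\in\widehat{\mathcal{E}}_2^S$; $\widehat{\mathcal{E}}$ is the set of sharp inter-personal equilibria.
   Formalization: The reference measure μ of the transition densities is assumed sigma-finite; for an arbitrary measure (e.g. counting measure on an uncountable space) the claim fails, since no Borel equilibrium need exist. *)

(* Defs.v *)
From HB Require Import structures.
From mathcomp Require Import all_boot all_order all_algebra.
From mathcomp Require Import all_classical all_reals all_analysis.

Set Implicit Arguments.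
Unset Strict Implicit.
Unset Printing Implicit Defensive.

Import Order.TTheory GRing.Theory Num.Theory.
Import numFieldNormedType.Exports.

Local Open Scope classical_set_scope.
Local Open Scope ring_scope.

(* The metric is existentially quantified: being Polish is a property of the
   topology of X alone. *)
Definition polish_space (R : realType) (X : topologicalType) : Prop :=
  (exists2 D : set X, countable D & dense D) /\
  exists dist : X -> X -> R,
    [/\ forall x y, dist x y = 0 <-> x = y,
        forall x y, dist x y = dist y x,
        forall x y z, dist x z <= dist x y + dist y z,
        forall (x : X) (U : set X),
          nbhs x U <-> exists2 e, 0 < e & [set y | dist x y < e] `<=` U
      & forall u : nat -> X,
          (forall e, 0 < e -> exists N, forall m n,
             (N <= m)%N -> (N <= n)%N -> dist (u m) (u n) < e) ->
          exists l : X, u @ \oo --> l].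

Notation borel X := (g_sigma_algebraType (@open X)).

Section canonical_space.
Variable X : ptopologicalType.

Definition cylinders (I : set nat) : set (set (nat -> X)) :=
  [set C | exists2 t, I t &
           exists2 A : set (borel X), measurable A & C = [set w | A (w t)]].

Definition path_space := g_sigma_algebraType (cylinders setT).

Definition natural_filtration (t : nat) : set (set path_space) :=
  <<s cylinders [set s | (s <= t)%N] >>.

Definition shift_path (t : nat) (w : path_space) : path_space :=
  fun s => w (t + s)%N.

(* Random times take values in nat extended with infinity, encoded as None. *)
Definition random_time := path_space -> option nat.

Definition le_time (tau : random_time) (t : nat) : set path_space :=
  [set w | if tau w is Some s then (s <= t)%N else false].

Definition stopping_time (tau : random_time) : Prop :=
  forall t, natural_filtration t (le_time tau t).

Definition stopped_sigma_algebra (tau : random_time) : set (set path_space) :=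
  [set A | measurable A /\
           forall t, natural_filtration t (A `&` le_time tau t)].

Definition hitting_from (m : nat) (S : set X) : random_time := fun w =>
  if pselect (exists t, `[< (m <= t)%N /\ S (w t) >]) is left hit
  then Some (ex_minn hit) else None.

Definition rho (S : set X) : random_time := hitting_from 0 S.
Definition rho_plus (S : set X) : random_time := hitting_from 1 S.

Definition time0 : random_time := fun=> Some 0%N.

End canonical_space.

Arguments time0 {X}.

Section processes.
Variables (R : realType) (X : ptopologicalType).
Implicit Types (Q : {measure set (path_space X) -> \bar R}).

(* Z is a version of the conditional expectation of Y given G under Q. *)
Definition is_cond_exp Q (G : set (set (path_space X)))
    (Y Z : path_space X -> R) : Prop :=
  [/\ Q.-integrable setT (EFin \o Y),
      Q.-integrable setT (EFin \o Z),
      (forall B : set R, measurable B -> G (Z @^-1` B))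
    & forall A, G A ->
        (\int[Q]_(w in A) (Z w)%:E = \int[Q]_(w in A) (Y w)%:E)%E].

Definition supermartingale Q (M : nat -> path_space X -> R) : Prop :=
  [/\ forall t (B : set R), measurable B -> natural_filtration t (M t @^-1` B),
      forall t, Q.-integrable setT (EFin \o M t)
    & forall s t, (s <= t)%N ->
        exists2 Z, is_cond_exp Q (natural_filtration s) (M t) Z
                 & {ae Q, forall w, Z w <= M s w}].

(* P x is the law on path space of the process started at x. The second clause
   is E_x[1_A o shift_tau | F_tau] = P_(X_tau)(A) on {tau < oo}. *)
Definition strong_markov (P : R.-pker borel X ~> path_space X) : Prop :=
  (forall x : X, P x [set w | w 0%N = x] = 1%E) /\
  forall tau : random_time X, stopping_time tau ->
  forall (x : X) (A : set (path_space X)), measurable A ->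
    is_cond_exp (P x) (stopped_sigma_algebra tau)
      (fun w => if tau w is Some t then \1_A (shift_path t w) else 0)
      (fun w => if tau w is Some t then fine (P (w t) A) else 0).

Definition transition_densities (P : R.-pker borel X ~> path_space X)
    (mu : {measure set (borel X) -> \bar R}) (p : nat -> X -> X -> R) : Prop :=
  forall t, (1 <= t)%N ->
    [/\ measurable_fun setT (fun xy : borel X * borel X => p t xy.1 xy.2),
        forall x y, 0 <= p t x y
      & forall (x : X) (A : set (borel X)), measurable A ->
          (P x [set w | A (w t)] = \int[mu]_(y in A) (p t x y)%:E)%E].

End processes.

Record player_data (R : realType) (X : Type) := PlayerData {
  disc : nat -> R ;
  pf : X -> R ;
  pg : X -> R ;
  ph : X -> R }.

Section game.
Variables (R : realType) (X : ptopologicalType).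
Variable P : R.-pker borel X ~> path_space X.
Implicit Types (G : player_data R X) (S T : set X) (x : X).
Implicit Types (tau sigma : random_time X).

Definition discount_function (d : nat -> R) : Prop :=
  [/\ forall t, 0 <= d t <= 1,
      forall s t, (s < t)%N -> d t < d s,
      d 0%N = 1
    & forall s t, d s * d t <= d (s + t)%N].

Definition payoff_function (u : X -> R) : Prop :=
  measurable_fun setT (u : borel X -> R) /\ forall x, 0 <= u x.

Definition admissible G : Prop :=
  [/\ discount_function (disc G),
      [/\ payoff_function (pf G), payoff_function (pg G)
        & payoff_function (ph G)]
    & forall x, (\int[P x]_w ereal_sup
        [set (disc G t * (pf G (w t) + pg G (w t) + ph G (w t)))%:E
          | t in [set t | (1 <= t)%N]] < +oo)%E].

(* tau is the stopping time of the player with data G, sigma the other's. *)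
Definition payoff G tau sigma (w : path_space X) : \bar R :=
  match tau w, sigma w with
  | Some t, Some s =>
      if (t < s)%N then (disc G t * pf G (w t))%:E
      else if (s < t)%N then (disc G s * pg G (w s))%:E
      else (disc G t * ph G (w t))%:E
  | Some t, None => (disc G t * pf G (w t))%:E
  | None, Some s => (disc G s * pg G (w s))%:E
  | None, None => limn_esup (fun t => (disc G t * ph G (w t))%:E)
  end.

Definition J G x tau sigma : \bar R := (\int[P x]_w payoff G tau sigma w)%E.

Definition Theta G T S : set X :=
  [set x | S x /\
    (J G x (rho_plus S) (rho T) <= J G x (time0) (rho T))%E] `|`
  [set x | ~ S x /\
    (J G x (rho_plus S) (rho T) < J G x (time0) (rho T))%E].

Definition policy S : Prop := measurable (S : set (borel X)).

Definition intra_equilibria G T : set (set X) :=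
  [set S | policy S /\ Theta G T S = S].

Definition equilibrium_value G T x S : \bar R :=
  Order.max (J G x (time0) (rho T)) (J G x (rho_plus S) (rho T)).

Definition optimal_equilibria G T : set (set X) :=
  [set S | intra_equilibria G T S /\
    forall S', intra_equilibria G T S' -> forall x,
      (equilibrium_value G T x S' <= equilibrium_value G T x S)%E].

Definition sharp_equilibria G1 G2 : set (set X * set X) :=
  [set ST | [/\ policy ST.1, policy ST.2,
                optimal_equilibria G1 ST.2 ST.1
              & optimal_equilibria G2 ST.1 ST.2]].

End game.

(* Main.v *)
Require Import Defs.
From HB Require Import structures.
From mathcomp Require Import all_boot all_order all_algebra.
From mathcomp Require Import all_classical all_reals all_analysis.
From mathcomp Require Import measurable_realfun.

Set Implicit Arguments.
Unset Strict Implicit.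
Unset Printing Implicit Defensive.

Import Order.TTheory GRing.Theory Num.Theory.
Import numFieldNormedType.Exports.

Local Open Scope classical_set_scope.
Local Open Scope ring_scope.

(** The proof fixes the opponent's policy [T] and studies a single player first.

    Replace simultaneous stopping by the payoff [pg]: at an equilibrium this
    changes nothing, because a player who stops on [T] must have [ph = pg] there.
    The continuation value [cont] of a policy [S] then depends only on the
    stopping region [S `|` T], and, thanks to the transition densities, only up
    to [mu]-null sets, which are never visited after time 0 ([ae_path]).

    Call [S] rational against [T] when waiting is at least as good as stopping
    almost everywhere outside [S `|` T]; every intra-personal equilibrium is
    rational. Discounting satisfies [d s * d t <= d (s + t)], so a player who
    prefers waiting at time 0 prefers it at every later clock time. Hence, when
    several rational policies are intersected, the player reaching a point where
    only some of them stop gains by following one that waits, and the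
    intersection has a larger continuation value than each of its members
    ([continuation_value_le]). Rational policies are therefore stable under
    countable intersections, and [mu] being sigma-finite they have a least
    element modulo null sets ([essential_minimum]). The least rational policy
    maximises the continuation value from every starting point, and stopping is
    strictly optimal almost everywhere on it, since otherwise it could be made
    smaller. It is an optimal equilibrium up to null sets.

    Next, enlarging [T] raises the continuation value ([cont_mono]): the game
    ends earlier with payoff [pg], and the discounted [pg] is a supermartingale.
    When neither player ever stops the payoff is an upper limit, so the
    comparison needs almost sure convergence of nonnegative supermartingales,
    obtained from Dubins' upcrossing inequality ([supermartingale_cvg]). Thus
    a larger [T] makes more policies rational, and the least rational policy is
    an antitone function of the opponent's policy. Composing the two players'
    best answers gives a monotone map modulo null sets, which has a fixed point
    by Tarski's argument ([mutual_least_rational]).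

    The resulting pair is an equilibrium off a null set. Redefining both
    policies on this null set by the equilibrium inequalities themselves, which
    leaves all continuation values unchanged, yields an exact sharp
    inter-personal equilibrium. *)

(** * Upper and lower limits of extended real sequences *)

Section limits_superior.
Context (R : realType).
Implicit Types u v : nat -> \bar R.

Lemma limn_esup_inf u : limn_esup u = ereal_inf (range (esups u)).
Proof. by rewrite limn_esup_lim; apply/cvg_lim => //; exact: cvg_esups_inf. Qed.

Lemma limn_einf_supE u : limn_einf u = ereal_sup (range (einfs u)).
Proof. by rewrite limn_einf_lim; apply/cvg_lim => //; exact: cvg_einfs_sup. Qed.

Lemma limn_esup_le_esups u n : (limn_esup u <= esups u n)%E.
Proof. by rewrite limn_esup_inf; apply: ereal_inf_lbound; exists n. Qed.

Lemma einfs_le_limn_einf u n : (einfs u n <= limn_einf u)%E.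
Proof. by rewrite limn_einf_supE; apply: ereal_sup_ubound; exists n. Qed.

Lemma le_limn_esup u v : (forall n, (u n <= v n)%E) ->
  (limn_esup u <= limn_esup v)%E.
Proof.
move=> uv; rewrite [leRHS]limn_esup_inf; apply: le_ereal_inf_tmp => _ [n _ <-].
apply: le_trans (limn_esup_le_esups u n) _.
apply: ge_ereal_sup => _ [k nk <-]; apply: le_trans (uv k) _.
by apply: ereal_sup_ubound; exists k.
Qed.

Lemma limn_esup_ge0 u : (forall n, (0 <= u n)%E) -> (0 <= limn_esup u)%E.
Proof.
move=> u0; rewrite limn_esup_inf; apply: le_ereal_inf_tmp => _ [n _ <-].
by apply: le_trans (u0 n) _; apply: ereal_sup_ubound; exists n => //=.
Qed.

Lemma esups_ge0 u n : (forall n, (0 <= u n)%E) -> (0 <= esups u n)%E.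
Proof.
move=> u0; apply: le_trans (u0 n) _; apply: ereal_sup_ubound.
by exists n => //=.
Qed.

Lemma esups_addn u k n : esups (fun t => u (k + t)%N) n = esups u (k + n).
Proof.
rewrite /esups /=; congr ereal_sup; apply/seteqP; split => [_ [t /= nt <-]|_ [t /= nt <-]].
  by exists (k + t)%N => //=; rewrite leq_add2l.
exists (t - k)%N; first by rewrite /= leq_subRL// (leq_trans _ nt)// leq_addr.
by rewrite subnKC// (leq_trans _ nt)// leq_addr.
Qed.

Lemma limn_esup_addn u k : limn_esup (fun t => u (k + t)%N) = limn_esup u.
Proof.
rewrite !limn_esup_inf; apply/eqP; rewrite eq_le; apply/andP; split.
  apply: le_ereal_inf_tmp => _ [n _ <-].
  apply: (@le_trans _ _ (esups (fun t => u (k + t)%N) n)).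
    by apply: ereal_inf_lbound; exists n.
  by rewrite esups_addn; apply: nonincreasing_esups; exact: leq_addl.
apply: le_ereal_inf_tmp => _ [n _ <-]; rewrite esups_addn.
by apply: ereal_inf_lbound; exists (k + n)%N.
Qed.

Lemma limn_esupZl (c : R) u : 0 < c ->
  limn_esup (fun n => c%:E * u n)%E = (c%:E * limn_esup u)%E.
Proof.
move=> c0; have E n : esups (fun n => c%:E * u n)%E n = (c%:E * esups u n)%E.
  rewrite /esups /= -ereal_sup_pZl//; congr ereal_sup.
  apply/seteqP; split => [_ [t nt <-]|_ [_ [t nt <-] <-]].
    by exists (u t) => //; exists t.
  by exists t.
rewrite !limn_esup_lim (_ : esups _ = (fun n => c%:E * esups u n)%E); last exact/funext.
by rewrite limeMl//; exact: is_cvg_esups.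
Qed.

End limits_superior.

(** * Nonnegative supermartingales *)

Section first_entry.
Variable T : Type.
Implicit Types (C : nat -> set T) (n s : nat).

Definition avoid C n s : set T := [set w | forall k, (n <= k < s)%N -> ~ C k w].

Definition first_entry C n s : set T := C s `&` avoid C n s.

Lemma avoid_refl C n : avoid C n n = setT.
Proof.
by apply/seteqP; split => // w _ k /andP[nk /(leq_ltn_trans nk)]; rewrite ltnn.
Qed.

Lemma avoidS C n s : (n <= s)%N -> avoid C n s.+1 = avoid C n s `&` ~` C s.
Proof.
move=> ns; apply/seteqP; split => [w av|w [av nC] k /andP[nk]].
  split; last by apply: av; rewrite ns ltnSn.
  by move=> k /andP[nk ks]; apply: av; rewrite nk ltnW.
by rewrite ltnS leq_eqVlt => /predU1P[-> //|ks]; apply: av; rewrite nk.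
Qed.

Lemma first_entry_inj C n s t w : (n <= s)%N -> (n <= t)%N ->
  first_entry C n s w -> first_entry C n t w -> s = t.
Proof.
move=> ns nt [Cs avs] [Ct avt]; have [st|ts|//] := ltngtP s t.
  by case: (avt s _ Cs); rewrite ns.
by case: (avs t _ Ct); rewrite nt.
Qed.

Lemma first_entry_exists C n s w : (n <= s)%N -> C s w ->
  exists2 t, (n <= t <= s)%N & first_entry C n t w.
Proof.
move=> ns Cs.
have ex : exists t, (n <= t)%N && `[< C t w >] by exists s; rewrite ns; apply/asboolP.
case: (ex_minnP ex) => t /andP[nt /asboolP Ct] tmin; exists t.
  by rewrite nt tmin// ns; apply/asboolP.
split=> // k /andP[nk kt] Ck; have := tmin k; rewrite nk /=.
by move=> /(_ (asboolT Ck)); rewrite leqNgt kt.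
Qed.

End first_entry.

Section supermartingale_theory.
Context d (T : measurableType d) (R : realType).
Variables (mu : {measure set T -> \bar R}) (G : nat -> set (set T)).
Local Notation F n := <<s G n >>.
Hypothesis Fincr : forall n, F n `<=` F n.+1.
Hypothesis Fmeas : forall n, F n `<=` @measurable d T.

Lemma filtration_le m n : (m <= n)%N -> F m `<=` F n.
Proof.
elim: n => [|n IHn]; first by rewrite leqn0 => /eqP ->.
rewrite leq_eqVlt => /predU1P[-> //|]; rewrite ltnS => /IHn mn A /mn.
exact: Fincr.
Qed.

Lemma filtrationI n A B : F n A -> F n B -> F n (A `&` B).
Proof. exact: (@measurableI _ (g_sigma_algebraType (G n))). Qed.

Lemma filtrationC n A : F n A -> F n (~` A).
Proof. exact: (@measurableC _ (g_sigma_algebraType (G n))). Qed.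

Lemma avoid_adapted (C : nat -> set T) n s : (forall k, F k (C k)) ->
  (n <= s)%N -> F s (avoid C n s).
Proof.
move=> FC /subnKC <-; elim: (s - n)%N => [|m IHm].
  by rewrite addn0 avoid_refl; exact: (@measurableT _ (g_sigma_algebraType _)).
rewrite addnS avoidS ?leq_addr//; apply: filtrationI; first exact: Fincr.
by apply: filtrationC; exact: Fincr.
Qed.

Lemma first_entry_adapted (C : nat -> set T) n s : (forall k, F k (C k)) ->
  (n <= s)%N -> F s (first_entry C n s).
Proof. by move=> FC ns; apply: filtrationI => //; exact: avoid_adapted. Qed.

Variable Y : nat -> T -> R.
Hypothesis Y0 : forall n w, 0 <= Y n w.
Hypothesis Yadapted : forall n (B : set R), measurable B -> F n (Y n @^-1` B).
Hypothesis Ystep : forall n A, F n A ->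
  (\int[mu]_(w in A) (Y n.+1 w)%:E <= \int[mu]_(w in A) (Y n w)%:E)%E.

Lemma adapted_measurable n : measurable_fun setT (Y n).
Proof. by move=> _ B mB; rewrite setTI; apply: Fmeas; exact: Yadapted. Qed.

(** The process frozen at its first entry in [C] after time [n] is still a
    supermartingale, so Fatou's lemma bounds the integral of whatever lies below
    its lower limit. *)
Lemma optional_stopping (C : nat -> set T) n B (V : T -> \bar R) :
  (forall k, F k (C k)) -> F n B ->
  measurable_fun B V -> (forall w, (0 <= V w)%E) ->
  (forall s w, (n <= s)%N -> B w -> first_entry C n s w -> (V w <= (Y s w)%:E)%E) ->
  {ae mu, forall w, B w -> (forall s, (n <= s)%N -> ~ C s w) ->
     (V w <= limn_einf (fun s => (Y s w)%:E))%E} ->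
  (\int[mu]_(w in B) V w <= \int[mu]_(w in B) (Y n w)%:E)%E.
Proof.
move=> FC FB mV V0 Vhit Vnever.
pose W := fix W m w : R := if m is m'.+1 then
  if w \in avoid C n (n + m) then Y (n + m)%N w else W m' w else Y n w.
have WS m w : W m.+1 w = if w \in avoid C n (n + m.+1) then Y (n + m.+1)%N w
  else W m w by [].
have mB : measurable B := Fmeas FB.
have Fav m : F (n + m)%N (avoid C n (n + m)).
  by apply: avoid_adapted => //; exact: leq_addr.
have mav m : measurable (avoid C n (n + m)) by exact: Fmeas (Fav m).
have W0 m w : 0 <= W m w.
  by elim: m => [|m IHm]; [exact: Y0|rewrite WS; case: ifP].
have Wav m w : avoid C n (n + m) w -> W m w = Y (n + m)%N w.
  case: m => [|m]; first by rewrite addn0.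
  by rewrite WS => /mem_set ->.
have mW m : measurable_fun setT (W m).
  elim: m => [|m IHm]; first exact: adapted_measurable.
  apply: measurable_fun_ifT => //; last exact: adapted_measurable.
  by apply: (measurable_fun_bool true); rewrite setTI preimage_mem_true.
have mWE m D : measurable_fun D (fun w => (W m w)%:E).
  by apply/measurable_EFinP; exact: measurable_funTS.
have mYE m D : measurable_fun D (fun w => (Y m w)%:E).
  by apply/measurable_EFinP; apply: measurable_funTS; exact: adapted_measurable.
have Wle m : (\int[mu]_(w in B) (W m w)%:E <= \int[mu]_(w in B) (Y n w)%:E)%E.
  elim: m => [//|m IHm]; apply: le_trans IHm.
  pose A := avoid C n (n + m.+1).
  have BE : B = (B `&` A) `|` (B `&` ~` A) by rewrite -setIUr setUv setIT.
  have mBA : measurable (B `&` A) by apply: measurableI => //; exact: mav.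
  have mBCA : measurable (B `&` ~` A).
    by apply: measurableI => //; apply: measurableC; exact: mav.
  have dis : [disjoint (B `&` A) & (B `&` ~` A)].
    by apply/eqP/seteqP; split => // w [[_ Aw] [_]].
  rewrite BE !ge0_integral_setU//; try by move=> w _; rewrite lee_fin.
  have AS : A `<=` avoid C n (n + m).
    by rewrite /A addnS avoidS ?leq_addr// => w [].
  apply: leeD.
    rewrite (eq_integral (fun w => (Y (n + m).+1 w)%:E)); last first.
      by move=> w /set_mem[_ Aw]; rewrite WS mem_set// addnS.
    rewrite [leRHS](eq_integral (fun w => (Y (n + m)%N w)%:E)); last first.
      by move=> w /set_mem[_ /AS Aw]; rewrite Wav.
    apply: Ystep; apply: filtrationI; first exact: filtration_le (leq_addr _ _) _ FB.
    rewrite /A addnS avoidS ?leq_addr//; apply: filtrationI; first exact: Fav.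
    exact: filtrationC.
  rewrite (eq_integral (fun w => (W m w)%:E))// => w /set_mem[_ nAw].
  by rewrite WS memNset.
apply: (@le_trans _ _ (\int[mu]_(w in B) limn_einf (fun m => (W m w)%:E))%E); last first.
  apply: le_trans; first by apply: fatou => // m w _; rewrite lee_fin.
  apply: (@le_trans _ _ (limn_esup (fun m => \int[mu]_(w in B) (W m w)%:E)%E)).
    exact: limn_einf_sup.
  rewrite limn_esup_lim; apply: lime_le; first exact: is_cvg_esups.
  by apply: nearW => m; apply: ge_ereal_sup => _ [k _ <-].
have mlim : measurable_fun B (fun w => limn_einf (fun m => (W m w)%:E)).
  rewrite /limn_einf; apply: measurableT_comp => //.
  by apply: measurable_fun_limn_esup => m; apply: measurableT_comp.
apply: ae_ge0_le_integral => //.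
  move=> w _; rewrite limn_einf_lim; apply: lime_ge; first exact: is_cvg_einfs.
  by apply: nearW => m; apply: le_ereal_inf_tmp => _ [k _ <-]; rewrite lee_fin.
apply: filterS Vnever => w Vw Bw.
have [[s ns Cs]|nev] := pselect (exists2 s, (n <= s)%N & C s w).
  have [t /andP[nt _] fe] := first_entry_exists ns Cs.
  have Wt m : (t - n <= m)%N -> W m w = Y t w.
    move=> /subnKC <-; elim: (m - _)%N => [|k IHk].
      by rewrite addn0 Wav subnKC//; exact: fe.2.
    rewrite addnS WS memNset// => /(_ t); apply; last exact: fe.1.
    by rewrite nt /= addnS addnA subnKC// ltnS leq_addr.
  rewrite limn_einf_lim; apply: lime_ge; first exact: is_cvg_einfs.
  exists (t - n)%N => // m /= tm; apply: le_ereal_inf_tmp => _ [k /= mk <-].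
  by rewrite Wt ?(leq_trans tm)//; exact: Vhit.
have nevC s : (n <= s)%N -> ~ C s w by move=> ns Cs; apply: nev; exists s.
apply: le_trans (Vw Bw nevC) _; rewrite !limn_einf_lim.
apply: lime_le; first exact: is_cvg_einfs.
apply: nearW => k; apply: lime_ge; first exact: is_cvg_einfs.
exists k => // m /= km; apply: le_ereal_inf_tmp => _ [j /= mj <-].
rewrite Wav; last by move=> i /andP[ni _]; exact: nevC.
apply: ereal_inf_lbound; exists (n + j)%N => //=.
by rewrite (leq_trans km)// (leq_trans mj)// leq_addl.
Qed.

Hypothesis mufin : (mu setT < +oo)%E.

(** Optional stopping at the first visit above [b]. *)
Lemma maximal_inequality n B (a b : R) : F n B -> 0 < b ->
  (forall w, B w -> Y n w <= a) ->
  (mu (B `&` [set w | exists2 s, (n <= s)%N & (b <= Y s w)%R]) <= (a / b)%:E * mu B)%E.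
Proof.
move=> FB b0 Ba; set U := [set w | _].
have mB : measurable B := Fmeas FB.
have FU k : F k [set w | b <= Y k w].
  rewrite (_ : [set w | _] = Y k @^-1` `[b, +oo[).
    by apply: Yadapted; exact: measurable_itv.
  by apply/seteqP; split => w /=; rewrite in_itv/= andbT.
have mU : measurable U.
  rewrite (_ : U = \bigcup_(k in [set k | (n <= k)%N]) [set w | b <= Y k w]).
    by apply: bigcup_measurable => k _; exact: Fmeas (FU k).
  by apply/seteqP; split => w [k nk bk]; exists k.
have h : (\int[mu]_(w in B) (b * \1_U w)%:E <= \int[mu]_(w in B) (Y n w)%:E)%E.
  apply: (@optional_stopping (fun k => [set w | b <= Y k w])) => //.
  - apply/measurable_EFinP.
    apply: measurable_funTS.
    apply: measurable_funM => //.

  - by move=> w; rewrite lee_fin mulr_ge0// ?ltW// indicE.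
  - move=> s w ns Bw [/= bY _]; rewrite lee_fin (le_trans _ bY)//.
    by rewrite ler_piMr ?(ltW b0)// indicE lern1 leq_b1.
  apply: aeW => w Bw never; rewrite indicE memNset ?mulr0; last first.
    by move=> [s ns bY]; exact: never ns bY.
  rewrite limn_einf_lim; apply: lime_ge; first exact: is_cvg_einfs.
  by apply: nearW => m; apply: le_ereal_inf_tmp => _ [k _ <-]; rewrite lee_fin.
have h1 : (\int[mu]_(w in B) (b * \1_U w)%:E = b%:E * mu (B `&` U))%E.
  under eq_integral do rewrite EFinM.
  rewrite ge0_integralZl_EFin ?ltW//; last first.
    by apply/measurable_EFinP; apply: measurable_funTS.
  by rewrite integral_indic// setIC.
have h2 : (\int[mu]_(w in B) (Y n w)%:E <= a%:E * mu B)%E.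
  rewrite -integral_cst//; apply: ge0_le_integral => //.
  - by move=> w _; rewrite lee_fin.
  - by apply/measurable_EFinP; apply: measurable_funTS; exact: adapted_measurable.
move: (le_trans h h2); rewrite h1 => h3.
by rewrite mulrC EFinM -muleA lee_pdivlMl.
Qed.

Lemma first_entry_decomposition (C : nat -> set T) n B H (q : R) :
  (forall k, F k (C k)) -> F n B -> measurable H -> 0 <= q ->
  (forall w, H w -> exists2 s, (n <= s)%N & C s w) ->
  (forall s, (n <= s)%N -> (mu (B `&` first_entry C n s `&` H)
     <= q%:E * mu (B `&` first_entry C n s))%E) ->
  (mu (B `&` H) <= q%:E * mu (B `&` [set w | exists2 s, (n <= s)%N & C s w]))%E.
Proof.
move=> FC FB mH q0 HC hs.
have mB : measurable B := Fmeas FB.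
pose D i := B `&` first_entry C n (n + i).
have mD i : measurable (D i).
  by apply: measurableI => //; apply: Fmeas; apply: first_entry_adapted (leq_addr _ _).
have tD : trivIset setT D.
  move=> i j _ _ [w [[_ fi] [_ fj]]]; apply: (@addnI n).
  by apply: (first_entry_inj _ _ fi fj); exact: leq_addr.
have DE : B `&` [set w | exists2 s, (n <= s)%N & C s w] = \bigcup_i D i.
  apply/seteqP; split => [w [Bw [s ns Cs]]|w [i _ [Bw fe]]].
    have [t /andP[nt _] fe] := first_entry_exists ns Cs.
    by exists (t - n)%N => //; split => //; rewrite subnKC.
  by split => //; exists (n + i)%N; [exact: leq_addr|exact: fe.1].
have HE : B `&` H = \bigcup_i (D i `&` H).
  rewrite -setI_bigcupl -DE; apply/seteqP; split => [w [Bw Hw]|w [[Bw _] Hw]] //.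
  by split => //; split => //; exact: HC.
rewrite DE HE !measure_bigcup//; last 2 first.
  - by move=> i _; exact: measurableI.
  - by apply: trivIset_setIr.
rewrite -nneseriesZl//; apply: lee_nneseries => // i _.
by apply: hs; exact: leq_addr.
Qed.

(** Dubins' inequality, in the limit of infinitely many upcrossings: each
    passage from below [a] to above [b] costs a factor [a / b]. *)
Lemma no_oscillation (a b : R) : 0 < a -> a < b ->
  mu.-negligible [set w | forall n, (exists2 s, (n <= s)%N & Y s w <= a) /\
                        (exists2 s, (n <= s)%N & b <= Y s w)].
Proof.
move=> a0 ab; set H := [set w | _].
have b0 : 0 < b by exact: lt_trans ab.
have FA k : F k [set w | Y k w <= a].
  rewrite (_ : [set w | _] = Y k @^-1` `]-oo, a]).
    by apply: Yadapted; exact: measurable_itv.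
  by apply/seteqP; split => w /=; rewrite in_itv.
have FU k : F k [set w | b <= Y k w].
  rewrite (_ : [set w | _] = Y k @^-1` `[b, +oo[).
    by apply: Yadapted; exact: measurable_itv.
  by apply/seteqP; split => w /=; rewrite in_itv/= andbT.
have mH : measurable H.
  rewrite (_ : H = \bigcap_n (
      (\bigcup_(k in [set k | (n <= k)%N]) [set w | Y k w <= a]) `&`
      (\bigcup_(k in [set k | (n <= k)%N]) [set w | b <= Y k w]))).
    apply: bigcapT_measurable => n; apply: measurableI.
      by apply: bigcup_measurable => k _; exact: Fmeas (FA k).
    by apply: bigcup_measurable => k _; exact: Fmeas (FU k).
  apply/seteqP; split => [w Hw n _|w Hw n].
    by have [[s ns As] [t nt Bt]] := Hw n; split; [exists s|exists t].
  by have [[s ns As] [t nt Bt]] := Hw n I; split; [exists s|exists t].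
have ab0 : 0 <= a / b by rewrite divr_ge0// ltW.
(* Splitting [B] at the first time below [a], and then at the first later time
   above [b], gains one factor of [a / b] per round. *)
have key k n B : F n B -> (mu (B `&` H) <= ((a / b) ^+ k)%:E * mu B)%E.
  elim: k n B => [|k IHk] n B FB.
    rewrite expr0 mul1e; apply: le_measure; rewrite ?inE//; last exact: Fmeas FB.
    by apply: measurableI => //; exact: Fmeas FB.
  have q0 : 0 <= (a / b) ^+ k by rewrite exprn_ge0.
  pose A k := [set w | Y k w <= a].
  apply: (@le_trans _ _ (((a / b) ^+ k.+1)%:E *
      mu (B `&` [set w | exists2 s, (n <= s)%N & A s w]))%E).
    apply: first_entry_decomposition => //.
    - by rewrite exprn_ge0.
    - by move=> w /(_ n)[].
    move=> s ns; set B' := B `&` _.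
    have FB' : F s B'.
      by apply: filtrationI; [exact: filtration_le FB|exact: first_entry_adapted].
    apply: (@le_trans _ _ (((a / b) ^+ k)%:E *
        mu (B' `&` [set w | exists2 t, (s <= t)%N & (b <= Y t w)%R]))%E).
      apply: (@first_entry_decomposition (fun t => [set w | b <= Y t w])) => //.
        by move=> w /(_ s)[].
      move=> t st; apply: IHk; apply: filtrationI; last exact: first_entry_adapted.
      exact: filtration_le FB'.
    rewrite exprSr EFinM -muleA; apply: lee_wpmul2l => //.
    by apply: maximal_inequality => // w [_ []].
  apply: lee_wpmul2l; first by rewrite lee_fin exprn_ge0.
  apply: le_measure; rewrite ?inE//; [|exact: Fmeas FB].
  apply: measurableI; first exact: Fmeas FB.
  rewrite (_ : [set w | _] = \bigcup_(k in [set k | (n <= k)%N]) A k).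
    by apply: bigcup_measurable => j _; exact: Fmeas (FA j).
  by apply/seteqP; split => w [j nj Aj]; exists j.
have {}key k : (mu H <= ((a / b) ^+ k)%:E * mu setT)%E.
  by rewrite -[H]setTI; apply: (@key k 0%N); exact: (@measurableT _ (g_sigma_algebraType _)).
have muTfin : mu setT \is a fin_num by rewrite ge0_fin_numE.
exists H; split => //; apply/eqP; rewrite eq_le measure_ge0 andbT.
have cv : (((a / b) ^+ k)%:E * mu setT)%E @[k --> \oo] --> 0%E.
  rewrite -(mul0e (mu setT)); apply: cvgeZr => //.
  apply: cvg_EFin; first by apply: nearW.
  apply: cvg_expr; rewrite ger0_norm// ltr_pdivrMr// mul1r//.
rewrite -(cvg_lim _ cv)//; apply: lime_ge; first by apply/cvg_ex; exists 0%E.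
by apply: nearW => k; exact: key.
Qed.

(** A path without limit crosses infinitely often some interval with positive
    rational endpoints. *)
Lemma supermartingale_cvg :
  {ae mu, forall w, (limn_esup (fun n => (Y n w)%:E)
                     <= limn_einf (fun n => (Y n w)%:E))%E}.
Proof.
pose osc (ab : rat * rat) : set T :=
  [set w | forall n, (exists2 s, (n <= s)%N & Y s w <= ratr ab.1) /\
                     (exists2 s, (n <= s)%N & ratr ab.2 <= Y s w)].
pose N i : set T := if unpickle i is Some ab then
  if (0 < ratr ab.1 :> R) && (ratr ab.1 < ratr ab.2 :> R) then osc ab else set0
  else set0.
have negN i : mu.-negligible (N i).
  rewrite /N; case: unpickle => [ab|]; last exact: negligible_set0.
  by case: ifPn => [/andP[a0 ab1]|_]; [exact: no_oscillation|exact: negligible_set0].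
apply: negligibleS (negligible_bigcup negN) => w /= /negP; rewrite -ltNge => lt.
set l := limn_einf _ in lt; set L := limn_esup _ in lt.
have l0 : (0 <= l)%E.
  rewrite /l limn_einf_supE; apply: le_trans (ereal_sup_ubound _); last by exists 0%N.
  by apply: le_ereal_inf_tmp => _ [k _ <-]; rewrite lee_fin.
have lfin : l \is a fin_num by rewrite ge0_fin_numE// (lt_le_trans lt)// leey.
have [M lM ML] : exists2 M : R, fine l < M & (M%:E <= L)%E.
  case: L lt => [L lt||]; last by rewrite ltNge leNye.
    by exists L => //; rewrite -lte_fin fineK.
  by move=> _; exists (fine l + 1); rewrite ?ltrDl// leey.
have [p] := rat_in_itvoo lM; rewrite in_itv/= => /andP[lp pM].
have [q] := rat_in_itvoo pM; rewrite in_itv/= => /andP[pq qM].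
have p0 : 0 < ratr p :> R by apply: le_lt_trans lp; rewrite -lee_fin fineK.
have NE : N (pickle (p, q)) = osc (p, q) by rewrite /N pickleK /= p0 pq.
exists (pickle (p, q)); [exact: I|rewrite NE].
move=> n; split.
  have /ereal_inf_lt[_ [s ns <-]] : (einfs (fun n => (Y n w)%:E) n < (ratr p)%:E)%E.
    apply: (@le_lt_trans _ _ l); first exact: einfs_le_limn_einf.
    by rewrite -(fineK lfin) lte_fin.
  by rewrite lte_fin => /ltW; exists s.
have /ereal_sup_gt[_ [s ns <-]] : ((ratr q)%:E < esups (fun n => (Y n w)%:E) n)%E.
  apply: (@lt_le_trans _ _ L); last exact: limn_esup_le_esups.
  by apply: lt_le_trans ML; rewrite lte_fin.
by rewrite lte_fin => /ltW; exists s.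
Qed.

End supermartingale_theory.

(** * Path space and the Markov property *)

Section canonical_paths.
Variable X : ptopologicalType.
Implicit Types (S : set X) (w : path_space X).

Lemma natural_filtration_eval n t (A : set (borel X)) : measurable A ->
  (t <= n)%N -> natural_filtration n [set w | A (w t)].
Proof. by move=> mA tn; apply: sub_gen_smallest; exists t => //; exists A. Qed.

Lemma natural_filtration_incr n :
  @natural_filtration X n `<=` natural_filtration n.+1.
Proof.
apply: sub_smallest2r; first exact: smallest_sigma_algebra.
by move=> C [t tn [A mA ->]]; exists t; [exact: leqW|exists A].
Qed.

Lemma natural_filtration_measurable n :
  @natural_filtration X n `<=` @measurable _ (path_space X).
Proof.
apply: sub_smallest2r; first exact: smallest_sigma_algebra.
by move=> C [t tn [A mA ->]]; exists t => //; exists A.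
Qed.

Lemma natural_filtrationT n : @natural_filtration X n setT.
Proof. exact: (@measurableT _ (g_sigma_algebraType _)). Qed.

Lemma natural_filtration0 n : @natural_filtration X n set0.
Proof. exact: (@measurable0 _ (g_sigma_algebraType _)). Qed.

Lemma natural_filtrationI n (A B : set (path_space X)) :
  natural_filtration n A -> natural_filtration n B -> natural_filtration n (A `&` B).
Proof. exact: (@measurableI _ (g_sigma_algebraType _)). Qed.

Lemma natural_filtrationC n (A : set (path_space X)) :
  natural_filtration n A -> natural_filtration n (~` A).
Proof. exact: (@measurableC _ (g_sigma_algebraType _)). Qed.

Lemma measurable_eval t :
  measurable_fun setT (fun w : path_space X => (w t : borel X)).
Proof.
move=> _ A mA; rewrite setTI.
exact: natural_filtration_measurable (natural_filtration_eval mA (leqnn t)).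
Qed.

Lemma measurable_shift_path n :
  measurable_fun setT (shift_path n : path_space X -> path_space X).
Proof.
apply: (@measurability _ _ (path_space X) (path_space X) setT (shift_path n)
  (cylinders setT)) => //.
move=> _ [_ [t _ [A mA ->]] <-]; rewrite setTI.
by have /(_ measurableT _ mA) := @measurable_eval (n + t); rewrite setTI.
Qed.

Variant hitting_spec m S w : option nat -> Type :=
| HitSome t of (m <= t)%N & S (w t) & (forall k, (m <= k < t)%N -> ~ S (w k)) :
    hitting_spec m S w (Some t)
| HitNone of (forall k, (m <= k)%N -> ~ S (w k)) : hitting_spec m S w None.

Lemma hittingP m S w : hitting_spec m S w (hitting_from m S w).
Proof.
rewrite /hitting_from; case: pselect => [ex|nex].
  case: ex_minnP => t /asboolP[mt St] tmin; constructor=> // k /andP[mk kt] Sk.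
  have /tmin : `[< (m <= k)%N /\ S (w k) >] by apply/asboolP.
  by rewrite leqNgt kt.
by constructor=> k mk Sk; apply: nex; exists k; apply/asboolP.
Qed.

Lemma hitting_eqSome m S w t : (m <= t)%N -> S (w t) ->
  (forall k, (m <= k < t)%N -> ~ S (w k)) -> hitting_from m S w = Some t.
Proof.
move=> mt St nS; case: hittingP => [s ms Ss nSs|/(_ _ mt St)//].
have [st|ts|-> //] := ltngtP s t.
  by case: (nS s _ Ss); rewrite ms.
by case: (nSs t _ St); rewrite mt.
Qed.

Lemma hitting_eqNone m S w : (forall k, (m <= k)%N -> ~ S (w k)) ->
  hitting_from m S w = None.
Proof. by move=> nS; case: hittingP => // t mt /nS. Qed.

Lemma eq_hitting m S S' w : (forall k, (m <= k)%N -> S (w k) <-> S' (w k)) ->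
  hitting_from m S w = hitting_from m S' w.
Proof.
move=> SS'; case: (hittingP m S' w) => [t mt St nS|nS].
  apply: hitting_eqSome => //; first exact/SS'.
  by move=> k /andP[mk kt] /SS' => /(_ mk); apply: nS; rewrite mk.
by apply: hitting_eqNone => k mk /SS' => /(_ mk); exact: nS.
Qed.

End canonical_paths.

Section markov_property.
Import HBNNSimple.
Variables (R : realType) (X : ptopologicalType).
Variable P : R.-pker borel X ~> path_space X.
Hypothesis hP : strong_markov P.

Lemma measurable_kernel_integral (h : path_space X -> \bar R) :
  (forall w, (0 <= h w)%E) -> measurable_fun setT h ->
  measurable_fun setT (fun x : borel X => \int[P x]_w h w)%E.
Proof.
move=> h0 mh; apply: measurable_fun_integral_kernel => // U mU.
exact: measurable_kernel.
Qed.

Lemma measurable_kernel_eval n (u : borel X -> \bar R) : measurable_fun setT u ->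
  measurable_fun setT (fun w : path_space X => u (w n)).
Proof. by move=> mu; exact: (measurableT_comp mu (@measurable_eval X n)). Qed.

Lemma markov_indic x n (B A : set (path_space X)) : natural_filtration n B ->
  measurable A ->
  (\int[P x]_(w in B) (\1_A (shift_path n w))%:E = \int[P x]_(w in B) P (w n) A)%E.
Proof.
move=> FB mA; pose tau : random_time X := fun=> Some n.
have st : stopping_time tau.
  move=> t; rewrite (_ : le_time tau t = if (n <= t)%N then setT else set0).
    case: ifP => _; first exact: natural_filtrationT.
    exact: natural_filtration0.
  by apply/seteqP; split => w; rewrite /le_time /=; case: (n <= t)%N.
have [_ _ _ /(_ B)] := hP.2 tau st x A mA; move=> <- //=.
  apply: eq_integral => w _; rewrite fineK//.
  rewrite ge0_fin_numE//; apply: le_lt_trans (ltry 1).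
  by rewrite -(@prob_kernel _ _ _ _ _ P (w n)); apply: le_measure; rewrite ?inE.
split; first exact: natural_filtration_measurable FB.
move=> t; have [nt|tn] := leqP n t.
  rewrite (_ : _ `&` _ = B).
    elim: t nt => [|t IHt]; first by rewrite leqn0 => /eqP <-.
    rewrite leq_eqVlt => /predU1P[<- //|]; rewrite ltnS => /IHt.
    exact: natural_filtration_incr.
  by apply/seteqP; split => [w []//|w Bw]; split => //=; rewrite /le_time /= nt.
rewrite (_ : _ `&` _ = set0); first exact: natural_filtration0.
by apply/seteqP; split => // w [_]; rewrite /le_time /= leqNgt tn.
Qed.

(** The strong Markov property at a constant time, extended from indicators to
    nonnegative functions by approximation from below. *)
Lemma markov_property x n (B : set (path_space X)) (h : path_space X -> \bar R) :
  natural_filtration n B -> (forall w, (0 <= h w)%E) -> measurable_fun setT h ->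
  (\int[P x]_(w in B) h (shift_path n w)
   = \int[P x]_(w in B) \int[P (w n)]_w' h w')%E.
Proof.
move=> FB h0 mh.
have mB : measurable B := natural_filtration_measurable FB.
pose g := nnsfun_approx measurableT mh.
have mg k : measurable_fun setT (EFin \o g k) by exact/measurable_EFinP.
have g0 k w : (0 <= (g k w)%:E)%E by rewrite lee_fin.
have gnd w : {homo (fun k => (g k w)%:E) : m k / (m <= k)%N >-> (m <= k)%E}.
  by move=> m k mk; rewrite lee_fin; exact/lefP/nd_nnsfun_approx.
have glim w : limn (fun k => (g k w)%:E) = h w.
  by apply/cvg_lim => //; exact: cvg_nnsfun_approx.
have mgs k : measurable_fun setT (fun w => (g k (shift_path n w))%:E).
  by apply: (measurableT_comp (mg k)); exact: measurable_shift_path.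
have step k : (\int[P x]_(w in B) (g k (shift_path n w))%:E
    = \int[P x]_(w in B) \int[P (w n)]_w' (g k w')%:E)%E.
  have ms r : measurable (g k @^-1` [set r]) by [].
  under eq_integral do rewrite fimfunE -fsumEFin//.
  rewrite ge0_integral_fsum//=; last 2 first.
  - move=> r; apply/measurable_EFinP/measurable_funTS/measurable_funM => //.
    by apply: (measurableT_comp _ (@measurable_shift_path X n)); exact: measurable_indic.
  - by move=> r w _; rewrite lee_fin; exact: nnfun_muleindic_ge0.
  under [RHS]eq_integral do rewrite integralT_nnsfun sintegralE.
  rewrite ge0_integral_fsum//=; last 2 first.
  - move=> r; apply: measurable_funTS; apply: measurable_funeM.
    apply: (@measurable_kernel_eval n (fun y => P y (g k @^-1` [set r]))).
    exact: measurable_kernel.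
  - by move=> r w _; exact: nnsfun_mulemu_ge0.
  apply: eq_fsbigr => r /set_mem[w0 _ gr].
  have r0 : 0 <= r by rewrite -gr.
  under eq_integral do rewrite EFinM.
  rewrite ge0_integralZl_EFin//; last first.
    apply/measurable_EFinP/measurable_funTS.
    by apply: (measurableT_comp _ (@measurable_shift_path X n)); exact: measurable_indic.
  rewrite ge0_integralZl_EFin// ?markov_indic//.
  apply: measurable_funTS; apply: (@measurable_kernel_eval n (fun y => P y _)).
  exact: measurable_kernel.
have c1 := @cvg_monotone_convergence _ _ _ (P x) B mB
  (fun k w => (g k (shift_path n w))%:E) (fun k => measurable_funTS (mgs k))
  (fun k w _ => g0 k _) (fun w _ => gnd _).
have mi k : measurable_fun setT (fun w : path_space X => \int[P (w n)]_w' (g k w')%:E)%E.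
  apply: (@measurable_kernel_eval n (fun y => \int[P y]_w' (g k w')%:E)%E).
  by apply: measurable_kernel_integral => [w|]; [exact: g0|exact: mg].
have ind w : {homo (fun k => \int[P (w n)]_w' (g k w')%:E)%E :
    m k / (m <= k)%N >-> (m <= k)%E}.
  move=> m k mk; apply: ge0_le_integral => //.
  - exact: mg.
  - exact: mg.
  - by move=> w' _; exact: gnd.
have c2 := @cvg_monotone_convergence _ _ _ (P x) B mB
  (fun k w => \int[P (w n)]_w' (g k w')%:E)%E (fun k => measurable_funTS (mi k))
  (fun k w _ => integral_ge0 _ (fun w' _ => g0 k w')) (fun w _ => ind w).
transitivity (limn (fun k => \int[P x]_(w in B) (g k (shift_path n w))%:E)%E).
  rewrite (cvg_lim _ c1)//; apply: eq_integral => w _; exact/esym/glim.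
rewrite (_ : (fun k => _) = (fun k => \int[P x]_(w in B) \int[P (w n)]_w' (g k w')%:E)%E);
  last by apply/funext => k; exact: step.
rewrite (cvg_lim _ c2)//; apply: eq_integral => w _ /=.
transitivity (\int[P (w n)]_w' limn (fun k => (g k w')%:E))%E; last first.
  by apply: eq_integral => w' _; exact: glim.
by apply/cvg_lim => //; exact: cvg_monotone_convergence.
Qed.

End markov_property.

Section integral_split.
Context d (T : measurableType d) (R : realType) (mu : {measure set T -> \bar R}).

Lemma ge0_integral_setC (A : set T) (f : T -> \bar R) : measurable A ->
  (forall w, (0 <= f w)%E) -> measurable_fun setT f ->
  (\int[mu]_w f w = \int[mu]_(w in A) f w + \int[mu]_(w in ~` A) f w)%E.
Proof.
move=> mA f0 mf; rewrite -{1}(setUv A) ge0_integral_setU//.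
- exact: measurableC.
- by rewrite setUv.
- by rewrite disj_set2E setICr.
Qed.

Lemma measurable_fun_setif (A : set T) (f g : T -> \bar R) : measurable A ->
  measurable_fun setT f -> measurable_fun setT g ->
  measurable_fun setT (fun w => if w \in A then f w else g w).
Proof.
move=> mA mf mg; apply: measurable_fun_ifT => //.
by apply: (measurable_fun_bool true); rewrite setTI preimage_mem_true.
Qed.

End integral_split.

Section hitting_measurability.
Variables (R : realType) (X : ptopologicalType).
Implicit Types D : set (borel X).

Definition visit (D : set X) (t : nat) : set (path_space X) := [set w | D (w t)].

Lemma visit_adapted D t : measurable D -> natural_filtration t (visit D t).
Proof. by move=> mD; exact: natural_filtration_eval. Qed.

Lemma hitting_first_entry m (D : set X) t : (m <= t)%N ->
  [set w | hitting_from m D w = Some t] = first_entry (visit D) m t.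
Proof.
move=> mt; apply/seteqP; split => w /=; last by case=> Dt av; exact: hitting_eqSome.
by case: hittingP => // s ms Ds nD [<-]; split.
Qed.

Lemma hitting_adapted m D t : measurable D ->
  natural_filtration t [set w | hitting_from m D w = Some t].
Proof.
move=> mD; have [mt|tm] := leqP m t; last first.
  rewrite (_ : [set w | _] = set0).
    exact: natural_filtration0.
  apply/seteqP; split => // w /=; case: hittingP => // s ms _ _ [st].
  by move: tm; rewrite -st ltnNge ms.
rewrite hitting_first_entry//.
exact: (@first_entry_adapted _ (path_space X) (fun n => cylinders [set s | (s <= n)%N])
  (@natural_filtration_incr X) _ _ _ (fun k => @visit_adapted D k mD) mt).
Qed.

Lemma avoid_visit_adapted D n : measurable D ->
  natural_filtration n (avoid (visit D) 1 n.+1).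
Proof.
move=> mD; case: n => [|n].
  by rewrite avoid_refl; exact: natural_filtrationT.
rewrite avoidS//; apply: natural_filtrationI; last first.
  by apply: natural_filtrationC; exact: visit_adapted.
exact: (@avoid_adapted _ (path_space X) (fun n => cylinders [set s | (s <= n)%N])
  (@natural_filtration_incr X) (visit D) 1 n.+1 (fun k => @visit_adapted D k mD)
  (ltn0Sn n)).
Qed.

Lemma measurable_hitting m D o : measurable D ->
  measurable [set w : path_space X | hitting_from m D w = o].
Proof.
have ms t : measurable D -> measurable [set w : path_space X | hitting_from m D w = Some t].
  by move=> mD; apply: natural_filtration_measurable; exact: hitting_adapted.
case: o => [t|] mD; first exact: ms.
rewrite (_ : [set w | _] = ~` \bigcup_t [set w | hitting_from m D w = Some t]).
  by apply: measurableC; apply: bigcupT_measurable => t; exact: ms.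
apply/seteqP; split => w /=; first by move=> E [t _]; rewrite /= E.
move=> nS; by case E : hitting_from => [t|//]; case: nS; exists t.
Qed.

(** Measurability of anything read off at a hitting time, the index [None]
    standing for paths that never hit. *)
Lemma measurable_at_hitting m D (F : option nat -> path_space X -> \bar R) :
  measurable D -> (forall o, measurable_fun setT (F o)) ->
  measurable_fun setT (fun w => F (hitting_from m D w) w).
Proof.
move=> mD mF _ B mB; rewrite setTI.
rewrite (_ : _ @^-1` B = ([set w | hitting_from m D w = None] `&` F None @^-1` B)
    `|` \bigcup_t ([set w | hitting_from m D w = Some t] `&` F (Some t) @^-1` B)).
  have mFB o : measurable (F o @^-1` B) by rewrite -[_ @^-1` _]setTI; exact: mF.
  apply: measurableU; first by apply: measurableI => //; exact: measurable_hitting.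
  by apply: bigcupT_measurable => t; apply: measurableI => //; exact: measurable_hitting.
apply/seteqP; split => w /=.
  by case E : hitting_from => [t|] FB; [right; exists t|left].
by case=> [[->]//|[t _ [/= ->]]].
Qed.

End hitting_measurability.

(** * Continuation values of a stopping region *)

Section stopping_region.
Variables (R : realType) (X : ptopologicalType).
Variables (d : nat -> R) (h r : X -> R).
Implicit Types (D : set X) (w : path_space X).

(** Payoff of entering [D] after time 0, seen with the discount clock already
    advanced by [s]. Discounting need not be exponential, so the expected payoff
    at [s = 0] obeys no dynamic programming equation alone; the family over
    all [s] does ([continuation_value_step]). *)
Definition gain (s : nat) D w : \bar R :=
  if hitting_from 1 D w is Some t then (d (s + t) * r (w t))%:E
  else limn_esup (fun t => (d (s + t) * h (w t))%:E).

Hypothesis d_ge0 : forall t, 0 <= d t.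
Hypothesis h0 : forall x, 0 <= h x.
Hypothesis r0 : forall x, 0 <= r x.

Lemma gain_ge0 s D w : (0 <= gain s D w)%E.
Proof.
rewrite /gain; case: hitting_from => [t|]; first by rewrite lee_fin mulr_ge0.
by apply: limn_esup_ge0 => t; rewrite lee_fin mulr_ge0.
Qed.

Lemma gain_shift s n D w : (forall k, (0 < k <= n)%N -> ~ D (w k)) ->
  gain s D w = gain (s + n) D (shift_path n w).
Proof.
move=> nD; rewrite /gain; case: (hittingP 1 D w) => [t t0 Dt nDt|nDw].
  have nt : (n < t)%N.
    by rewrite ltnNge; apply/negP => tn; apply: (nD t) => //; rewrite t0.
  rewrite (@hitting_eqSome _ 1 D _ (t - n)) ?subn_gt0//.
  - by rewrite /shift_path -addnA subnKC// ltnW.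
  - by rewrite /shift_path subnKC// ltnW.
  - move=> k /andP[k0 kt]; rewrite /shift_path; apply: nDt.
    by rewrite (leq_trans k0) ?leq_addl//= -ltn_subRL.
rewrite hitting_eqNone; last first.
  by move=> k k1; apply: nDw; rewrite (leq_trans k1)// leq_addl.
rewrite -(@limn_esup_addn _ _ n); congr limn_esup; apply/funext => t.
by rewrite /shift_path addnA.
Qed.

Lemma gain_discount s D w : 0 < d s ->
  (forall t u, d t * d u <= d (t + u)) ->
  ((d s)%:E * gain 0 D w <= gain s D w)%E.
Proof.
move=> ds dM; rewrite /gain; case: hitting_from => [t|].
  by rewrite add0n -EFinM lee_fin mulrA ler_wpM2r.
rewrite -limn_esupZl//; apply: le_limn_esup => t.
by rewrite -EFinM lee_fin mulrA ler_wpM2r.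
Qed.

Hypothesis mh : measurable_fun setT (h : borel X -> R).
Hypothesis mr : measurable_fun setT (r : borel X -> R).

Lemma measurable_discounted s n (u : X -> R) :
  measurable_fun setT (u : borel X -> R) ->
  measurable_fun setT (fun w : path_space X => (d s * u (w n))%:E).
Proof.
move=> mu; apply/measurable_EFinP/measurable_funM => //.
exact: (measurableT_comp mu (@measurable_eval X n)).
Qed.

Lemma measurable_gain s (D : set (borel X)) : measurable D ->
  measurable_fun setT (gain s D).
Proof.
move=> mD; apply: (@measurable_at_hitting R X 1 D
  (fun o w => if o is Some t then (d (s + t) * r (w t))%:E
   else limn_esup (fun t => (d (s + t) * h (w t))%:E))) => // -[t|].
  exact: measurable_discounted.
by apply: measurable_fun_limn_esup => t; exact: measurable_discounted.
Qed.

Variable P : R.-pker borel X ~> path_space X.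

Definition continuation_value s D (x : X) : \bar R := (\int[P x]_w gain s D w)%E.

Lemma continuation_value_ge0 s D x : (0 <= continuation_value s D x)%E.
Proof. by apply: integral_ge0 => w _; exact: gain_ge0. Qed.

Lemma measurable_continuation_value s (D : set (borel X)) : measurable D ->
  measurable_fun setT (continuation_value s D : borel X -> \bar R).
Proof.
move=> mD; apply: measurable_kernel_integral; first by move=> w; exact: gain_ge0.
exact: measurable_gain.
Qed.

(** Decreasing impatience: if continuing beats stopping with the clock at 0, it
    still does with the clock at [s]. *)
Lemma continuation_value_discount s (D : set (borel X)) x : measurable D ->
  0 < d s -> (forall t u, d t * d u <= d (t + u)) ->
  ((d s)%:E * continuation_value 0 D x <= continuation_value s D x)%E.
Proof.
move=> mD ds dM; rewrite /continuation_value -ge0_integralZl_EFin ?(ltW ds)//.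
- apply: ge0_le_integral => //.
  + by move=> w _; rewrite mule_ge0 ?lee_fin ?(ltW ds)// gain_ge0.
  + by apply: measurable_funeM; exact: measurable_gain.
  + exact: measurable_gain.
  + by move=> w _; exact: gain_discount.
- by move=> w _; exact: gain_ge0.
- exact: measurable_gain.
Qed.

Hypothesis hP : strong_markov P.

Lemma continuation_value_step s (D : set (borel X)) x : measurable D ->
  continuation_value s D x = (\int[P x]_w (if w 1%N \in D then (d s.+1 * r (w 1%N))%:E
    else continuation_value s.+1 D (w 1%N)))%E.
Proof.
move=> mD; have mV : measurable (visit D 1).
  exact: natural_filtration_measurable (visit_adapted mD).
have ite : measurable_fun setT (fun w : path_space X => if w 1%N \in D
    then (d s.+1 * r (w 1%N))%:E else continuation_value s.+1 D (w 1%N)).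
  apply: (@measurable_fun_setif _ (path_space X) R (visit D 1)) => //.
    exact: measurable_discounted.
  by apply: measurable_kernel_eval; exact: measurable_continuation_value.
rewrite [LHS](@ge0_integral_setC _ _ _ _ (visit D 1))//; last 2 first.
- by move=> w; exact: gain_ge0.
- exact: measurable_gain.
rewrite [RHS](@ge0_integral_setC _ _ _ _ (visit D 1))//; last first.
  move=> w; case: ifP => _; first by rewrite lee_fin mulr_ge0.
  exact: continuation_value_ge0.
congr (_ + _)%E.
  apply: eq_integral => w /set_mem Dw; rewrite ifT; last exact/mem_set.
  rewrite /gain (@hitting_eqSome _ _ _ _ 1) ?addn1// => k /andP[k1].
  by rewrite ltnNge k1.
rewrite (eq_integral (fun w => gain s.+1 D (shift_path 1 w))); last first.
  move=> w /set_mem nDw; rewrite -addn1 -gain_shift// => k.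
  by case: k => [|[|]].
rewrite markov_property//.
- apply: eq_integral => w /set_mem nDw; rewrite ifF//.
  by apply/negP => /set_mem.
- by apply: natural_filtrationC; exact: visit_adapted.
- by move=> w; exact: gain_ge0.
- exact: measurable_gain.
Qed.

Variable k : X -> R.
Hypothesis hk : forall x, h x <= k x.
Hypothesis rk : forall x, r x <= k x.
Hypothesis mk : measurable_fun setT (k : borel X -> R).
Hypothesis k_int : forall x : X,
  (\int[P x]_w esups (fun t => (d t * k (w t))%:E) 1%N < +oo)%E.
Hypothesis d_gt0 : forall t, 0 < d t.
Hypothesis d_mul : forall t u, d t * d u <= d (t + u).

Let k0 x : 0 <= k x. Proof. exact: le_trans (h0 x) (hk x). Qed.

Definition envelope (n : nat) (u : X -> R) w : \bar R :=
  esups (fun t => (d (n + t) * u (w t))%:E) 1%N.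

Lemma le_envelope n (u : X -> R) w t : (0 < t)%N ->
  ((d (n + t) * u (w t))%:E <= envelope n u w)%E.
Proof. by move=> t0; apply: ereal_sup_ubound; exists t. Qed.

Lemma envelope_shift n (u : X -> R) w :
  envelope n u (shift_path n w) = esups (fun t => (d t * u (w t))%:E) n.+1.
Proof. by rewrite /envelope -[n.+1]addn1 -(esups_addn (fun t => (d t * u (w t))%:E)). Qed.

Lemma envelope_ge0 n (u : X -> R) w : (forall x, 0 <= u x) ->
  (0 <= envelope n u w)%E.
Proof. by move=> u0; apply: esups_ge0 => t; rewrite lee_fin mulr_ge0. Qed.

Lemma measurable_envelope n (u : X -> R) : measurable_fun setT (u : borel X -> R) ->
  measurable_fun setT (envelope n u).
Proof.
move=> mu; apply: (@measurable_fun_esups _ (path_space X) R) => t.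
exact: measurable_discounted.
Qed.

Lemma gain_le_envelope n D w : (gain n D w <= envelope n k w)%E.
Proof.
rewrite /gain; case: hittingP => [t t0 _ _|_].
  by apply: le_trans (le_envelope n k w t0); rewrite lee_fin ler_wpM2l.
apply: le_trans (limn_esup_le_esups _ 1) _; apply: ge_ereal_sup => _ [t /= t0 <-].
by apply: le_trans (le_envelope n k w t0); rewrite lee_fin ler_wpM2l.
Qed.

(** The region [E] lies in every [D i], and wherever it waits, continuing with
    some [D j] is worth at least the reward of stopping. Let [best n] be the
    largest continuation value at clock [n]. One step of the chain does not
    decrease it, as long as [E] is not entered: stopping at a point of [D i]
    outside [E] is worth at most [best] again. Iterating up to time [n] compares [best 0] with the payoff of [E] on
    the paths that enter [E] by time [n], plus a remainder. *)
Section comparison.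
Variables (D : nat -> set (borel X)) (E : set (borel X)).
Hypothesis mD : forall i, measurable (D i).
Hypothesis mE : measurable E.
Hypothesis ED : forall i, E `<=` D i.
Hypothesis rh : forall y, ~ E y -> r y <= h y.
Hypothesis rational : forall y, {ae P y, forall w, ~ E (w 1%N) ->
  exists j, ((r (w 1%N))%:E <= continuation_value 0 (D j) (w 1%N))%E}.

Let never : set (path_space X) := [set w | forall t, (0 < t)%N -> ~ E (w t)].

Let free n : set (path_space X) := avoid (visit E) 1 n.+1.

Let best n (y : X) : \bar R := esups (fun i => continuation_value n (D i) y) 0.

(** On paths that never enter [E] the payoff of [D i] after time [n] is bounded
    by values of [h], because [r <= h] outside [E]. This makes the remainder
    converge to the upper limit paid by [E] on those paths. *)
Let tail_bound n w : \bar R := if w \in never then envelope n h w else envelope n k w.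

Let mfree n : measurable (free n).
Proof. by apply: natural_filtration_measurable; exact: avoid_visit_adapted. Qed.

Let mnever : measurable never.
Proof.
rewrite (_ : never = [set w | hitting_from 1 E w = None]); first exact: measurable_hitting.
apply/seteqP; split => w /= nE; first exact: hitting_eqNone.
by move=> t t0 Et; move: nE; case: hittingP => // nE _; exact: nE Et.
Qed.

Let mbest n : measurable_fun setT (best n : borel X -> \bar R).
Proof. by apply: measurable_fun_esups => i; exact: measurable_continuation_value. Qed.

Let best_ge0 n y : (0 <= best n y)%E.
Proof. by apply: esups_ge0 => i; exact: continuation_value_ge0. Qed.

Let le_best n i y : (continuation_value n (D i) y <= best n y)%E.
Proof. by apply: ereal_sup_ubound; exists i. Qed.

Let mtail n : measurable_fun setT (tail_bound n).
Proof. by apply: measurable_fun_setif => //; exact: measurable_envelope. Qed.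

Let tail_ge0 n w : (0 <= tail_bound n w)%E.
Proof. by rewrite /tail_bound; case: ifP => _; exact: envelope_ge0. Qed.

Let gain_le_tail n i w : (gain n (D i) w <= tail_bound n w)%E.
Proof.
rewrite /tail_bound; case: ifPn => [/set_mem nE|_]; last exact: gain_le_envelope.
rewrite /gain; case: hittingP => [t t0 _ _|_].
  apply: le_trans (le_envelope n h w t0).
  by rewrite lee_fin ler_wpM2l// rh//; exact: nE.
apply: le_trans (limn_esup_le_esups _ 1) _; apply: ge_ereal_sup => _ [t /= t0 <-].
exact: le_envelope.
Qed.

Let best_le_tail n y : (best n y <= \int[P y]_w tail_bound n w)%E.
Proof.
apply: ge_ereal_sup => _ [i _ <-]; apply: ge0_le_integral => //.
- by move=> w _; exact: gain_ge0.
- exact: measurable_gain.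
Qed.

(** What clock [n] finds at [y]: the payoff of stopping there if [E] does, and
   otherwise the right to choose the best region again. *)
Let next n y : \bar R := if y \in E then (d n * r y)%:E else best n y.

Let mnext n : measurable_fun setT (next n : borel X -> \bar R).
Proof.
apply: measurable_fun_setif => //.
by apply/measurable_EFinP/measurable_funM.
Qed.

Let next_ge0 n y : (0 <= next n y)%E.
Proof. by rewrite /next; case: ifP => // _; rewrite lee_fin mulr_ge0. Qed.

Let best_step n y : (best n y <= \int[P y]_w next n.+1 (w 1%N))%E.
Proof.
apply: ge_ereal_sup => _ [i _ <-]; rewrite continuation_value_step//.
have mV : measurable (visit (D i) 1).
  exact: natural_filtration_measurable (visit_adapted (mD i)).
apply: ae_ge0_le_integral => //.
- move=> w _; case: ifP => _; first by rewrite lee_fin mulr_ge0.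
  exact: continuation_value_ge0.
- apply: (@measurable_fun_setif _ (path_space X) R (visit (D i) 1)) => //.
    exact: measurable_discounted.
  by apply: measurable_kernel_eval; exact: measurable_continuation_value.
- exact: (@measurable_kernel_eval R X 1 (next n.+1)).
apply: filterS (rational y) => w rat _; rewrite /next.
case: ifPn => [Dw|/negP nDw]; last first.
  by rewrite ifF//; apply/negP => /set_mem /(ED i) /mem_set.
case: ifPn => // /negP nEw.
have [j rj] := rat (fun Ew => nEw (mem_set Ew)).
apply: le_trans (le_best n.+1 j (w 1%N)).
apply: le_trans (continuation_value_discount _ (mD j) (d_gt0 _) d_mul).
by rewrite EFinM; apply: lee_wpmul2l; rewrite ?lee_fin.
Qed.

(** Play [E] up to time [n], then collect [best n]. *)
Let mix n w : \bar R := if w \in free n then best n (w n) else gain 0 E w.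

Let mmix n : measurable_fun setT (mix n).
Proof.
apply: measurable_fun_setif => //; last exact: measurable_gain.
exact: (@measurable_kernel_eval R X n (best n)).
Qed.

Let mix_ge0 n w : (0 <= mix n w)%E.
Proof. by rewrite /mix; case: ifP => // _; exact: gain_ge0. Qed.

Let mixE n w : free n w -> mix n.+1 w = next n.+1 (w n.+1).
Proof.
move=> fw; rewrite /mix /next; have freeS : free n.+1 w <-> ~ E (w n.+1).
  by rewrite /free avoidS//; split => [[]|]//.
case: ifPn => [/set_mem/freeS nE|/negP nf].
  by rewrite ifF//; apply/negP => /set_mem.
have Ew : E (w n.+1).
  by apply: contrapT => nE; apply: nf; apply/mem_set/freeS.
rewrite ifT; last exact/mem_set.
by rewrite /gain (@hitting_eqSome _ 1 E w n.+1).
Qed.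

Let best_le_mix1 x : (best 0 x <= \int[P x]_w mix 1 w)%E.
Proof.
apply: le_trans (best_step 0 x) _; rewrite (eq_integral (mix 1))// => w _.
by rewrite -mixE// /free avoid_refl.
Qed.

Let mix_step n x : (\int[P x]_w mix n w <= \int[P x]_w mix n.+1 w)%E.
Proof.
rewrite (ge0_integral_setC (P x) (mfree n) (mix_ge0 n) (mmix n)).
rewrite (ge0_integral_setC (P x) (mfree n) (mix_ge0 n.+1) (mmix n.+1)).
apply: leeD; last first.
  rewrite le_eqVlt; apply/orP; left; apply/eqP.
  apply: eq_integral => w /set_mem nf; rewrite /mix !ifF//; apply/negP => /set_mem //.
  by rewrite /free avoidS// => -[].
rewrite (eq_integral (fun w => best n (w n))); last by move=> w fw; rewrite /mix fw.
rewrite [leRHS](eq_integral (fun w => next n.+1 (shift_path n w 1%N))); last first.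
  by move=> w /set_mem fw; rewrite mixE// /shift_path addn1.
rewrite (@markov_property R X P hP x n (free n) (fun w => next n.+1 (w 1%N)))//.
- apply: ge0_le_integral => //.
  + by apply: measurable_funTS; exact: (@measurable_kernel_eval R X n (best n)).
  + apply: measurable_funTS.
    apply: (@measurable_kernel_eval R X n (fun y => \int[P y]_w next n.+1 (w 1%N))%E).
    apply: measurable_kernel_integral => //.
    exact: (@measurable_kernel_eval R X 1 (next n.+1)).
- exact: avoid_visit_adapted.
- exact: (@measurable_kernel_eval R X 1 (next n.+1)).
Qed.

(** [mix n] with [best n] replaced by its bound along the path, which makes the
   limit in [n] a case of dominated convergence. *)
Let dom n w : \bar R := if w \in free n then tail_bound n (shift_path n w) else gain 0 E w.

Let mdom n : measurable_fun setT (dom n).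
Proof.
apply: measurable_fun_setif => //; last exact: measurable_gain.
exact: (measurableT_comp (mtail n) (@measurable_shift_path X n)).
Qed.

Let dom_ge0 n w : (0 <= dom n w)%E.
Proof. by rewrite /dom; case: ifP => // _; exact: gain_ge0. Qed.

Let mix_le_dom n x : (\int[P x]_w mix n w <= \int[P x]_w dom n w)%E.
Proof.
rewrite (ge0_integral_setC (P x) (mfree n) (mix_ge0 n) (mmix n)).
rewrite (ge0_integral_setC (P x) (mfree n) (dom_ge0 n) (mdom n)).
apply: leeD; last first.
  rewrite le_eqVlt; apply/orP; left; apply/eqP.
  by apply: eq_integral => w /set_mem nf; rewrite /mix /dom !ifF//; apply/negP => /set_mem.
rewrite (eq_integral (fun w => best n (w n))); last by move=> w fw; rewrite /mix fw.
rewrite [leRHS](eq_integral (fun w => tail_bound n (shift_path n w))); last first.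
  by move=> w fw; rewrite /dom fw.
rewrite markov_property//; last exact: avoid_visit_adapted.
apply: ge0_le_integral => //.
- by apply: measurable_funTS; exact: (@measurable_kernel_eval R X n (best n)).
- apply: measurable_funTS.
  apply: (@measurable_kernel_eval R X n (fun y => \int[P y]_w tail_bound n w)%E).
  exact: measurable_kernel_integral.
Qed.

Let dom_cvg w : dom n w @[n --> \oo] --> gain 0 E w.
Proof.
have [nE|Ew] := pselect (never w).
  have -> : gain 0 E w = limn (esups (fun t => (d t * h (w t))%:E)).
    rewrite -limn_esup_lim /gain hitting_eqNone//.
  have -> : (fun n => dom n w) = (fun n => esups (fun t => (d t * h (w t))%:E) n.+1).
    apply/funext => n; rewrite /dom ifT; last first.
      by apply/mem_set => t /andP[t0 _]; exact: nE.
    rewrite /tail_bound ifT ?envelope_shift//.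
    by apply/mem_set => t t0; apply: nE; rewrite addn_gt0 t0 orbT.
  by rewrite (cvg_shiftS (esups _)); exact: is_cvg_esups.
have [t t0 Et] : exists2 t, (0 < t)%N & E (w t).
  apply: contrapT => nex; apply: Ew => t t0 Et; apply: nex; exists t => //.
apply: cvg_near_cst; exists t => // n /= tn; rewrite /dom ifF//.
apply/negP => /set_mem /(_ t); apply; last exact: Et.
by rewrite t0/= ltnS.
Qed.

Let dom_le_envelope n w : (dom n w <= envelope 0 k w)%E.
Proof.
rewrite /dom; case: ifP => _; last exact: gain_le_envelope.
have kle : (envelope n k (shift_path n w) <= envelope 0 k w)%E.
  by rewrite envelope_shift /envelope; apply: nonincreasing_esups.
rewrite /tail_bound; case: ifP => _ //; apply: le_trans kle.
apply: ge_ereal_sup => _ [t /= t0 <-].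
by apply: le_trans (le_envelope n k _ t0); rewrite lee_fin ler_wpM2l.
Qed.

Lemma continuation_value_le x i :
  (continuation_value 0 (D i) x <= continuation_value 0 E x)%E.
Proof.
(* Starting the iteration at 1 avoids evaluating [best 0] at the random point
   [w 0]. *)
have bound n : (best 0 x <= \int[P x]_w dom n.+1 w)%E.
  apply: le_trans (mix_le_dom n.+1 x); elim: n => [|n IHn]; first exact: best_le_mix1.
  exact: le_trans IHn (mix_step _ _).
have [_ _ cv] : [/\ (P x).-integrable setT (gain 0 E),
    [sequence (\int[P x]_w `|dom n w - gain 0 E w|)%E]_n @ \oo --> 0%E
  & [sequence (\int[P x]_w dom n w)%E]_n @ \oo --> (\int[P x]_w gain 0 E w)%E].
  apply: (@dominated_convergence _ _ _ _ _ measurableT dom (gain 0 E) (envelope 0 k)) => //.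
  - exact: measurable_gain.
  - by apply: aeW => w _; exact: dom_cvg.
  - apply/integrableP; split; first exact: measurable_envelope.
    under eq_integral do rewrite gee0_abs ?envelope_ge0//.
    exact: k_int.
  - by apply: aeW => w n _; rewrite gee0_abs//; exact: dom_le_envelope.
apply: le_trans (le_best 0 i x) _; rewrite /continuation_value -(cvg_lim _ cv)//.
apply: lime_ge; first by apply/cvg_ex; eexists; exact: cv.
by exists 1%N => // -[//|n] _; exact: bound.
Qed.

End comparison.

End stopping_region.

(** * One player against a fixed opponent *)

Section transition_null_sets.
Variables (R : realType) (X : ptopologicalType).
Variables (P : R.-pker borel X ~> path_space X).
Variables (mu : {measure set (borel X) -> \bar R}) (p : nat -> X -> X -> R).
Hypothesis hp : transition_densities P mu p.

(** With transition densities, every law of [w t], [t > 0], is absolutely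
    continuous with respect to [mu], whatever the starting point. *)
Lemma ae_path (Q : X -> Prop) x : {ae mu, forall y : borel X, Q y} ->
  {ae P x, forall w : path_space X, forall t, (0 < t)%N -> Q (w t)}.
Proof.
move=> [N [mN N0 QN]].
suff aeN t : {ae P x, forall w : path_space X, (0 < t)%N -> ~ N (w t)}.
  apply: filterS (ae_foralln aeN) => w nN t t0; apply: contrapT => nQ.
  by apply: (nN t t0); exact: QN.
have [->|t0] := posnP t; first by apply: aeW.
exists (visit N t); split.
- by apply: natural_filtration_measurable; exact: visit_adapted.
- have [mp _ /(_ x N mN) ->] := hp t0.
  apply: null_set_integral => //; apply/measurable_EFinP/measurable_funTS.
  exact: (measurableT_comp mp (pair1_measurable x)).
- by move=> w /= h; apply: contrapT => nN; apply: h.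
Qed.

End transition_null_sets.

Section player.
Variables (R : realType) (X : ptopologicalType).
Variables (P : R.-pker borel X ~> path_space X) (G : player_data R X).
Hypothesis hP : strong_markov P.
Hypothesis hG : admissible P G.
Hypothesis hfhg : forall x, pf G x <= ph G x <= pg G x.
Implicit Types (S T : set (borel X)) (x : X).

Definition reward T (y : X) : R := if y \in T then pg G y else pf G y.

(** Value of continuing against [T] when the player stops on [S], computed as
    if simultaneous stopping paid [pg]. It is the true value outside [T] whenever
    [ph = pg] on [S `&` T], in particular at an equilibrium, and it depends on
    [S] only through [S `|` T]. *)
Definition cont T S x : \bar R :=
  continuation_value (disc G) (ph G) (reward T) P 0 (S `|` T) x.

Let d0 t : 0 <= disc G t. Proof. by case: hG => [[/(_ t)/andP[]]]. Qed.
Let dM t u : disc G t * disc G u <= disc G (t + u)%N.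
Proof. by case: hG => [[]]. Qed.
Let dpos t : 0 < disc G t.
Proof. by case: hG => -[_ ds _ _] _ _; exact: le_lt_trans (d0 t.+1) (ds _ _ (ltnSn t)). Qed.
Let f0 x : 0 <= pf G x. Proof. by case: hG => _ [[]]. Qed.
Let g0 x : 0 <= pg G x. Proof. by case: hG => _ [_ []]. Qed.
Let h0 x : 0 <= ph G x. Proof. by case: hG => _ [_ _ []]. Qed.
Let mf : measurable_fun setT (pf G : borel X -> R). Proof. by case: hG => _ [[]]. Qed.
Let mg : measurable_fun setT (pg G : borel X -> R). Proof. by case: hG => _ [_ []]. Qed.
Let mh : measurable_fun setT (ph G : borel X -> R). Proof. by case: hG => _ [_ _ []]. Qed.

Let reward0 T x : 0 <= reward T x.
Proof. by rewrite /reward; case: ifP. Qed.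

Let mreward T : measurable T -> measurable_fun setT (reward T : borel X -> R).
Proof.
move=> mT; apply: measurable_fun_ifT => //.
by apply: (measurable_fun_bool true); rewrite setTI preimage_mem_true.
Qed.

Let reward_le_pg T x : reward T x <= pg G x.
Proof.
rewrite /reward; case: ifP => // _; have /andP[fh hg] := hfhg x.
exact: le_trans fh hg.
Qed.

Local Notation gainT T := (gain (disc G) (ph G) (reward T) 0).

Let mgain T (D : set (borel X)) : measurable T -> measurable D ->
  measurable_fun setT (gainT T D).
Proof. by move=> mT mD; apply: measurable_gain => //; exact: mreward. Qed.

Let gain0 T (D : set X) w : (0 <= gainT T D w)%E.
Proof. exact: gain_ge0. Qed.

Lemma measurable_cont T S : measurable T -> measurable S ->
  measurable_fun setT (cont T S : borel X -> \bar R).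
Proof.
move=> mT mS; apply: measurable_continuation_value => //; first exact: mreward.
exact: measurableU.
Qed.

Lemma cont_le T (D : nat -> set (borel X)) S x i : measurable T ->
  (forall j, measurable (D j)) -> measurable S -> (forall j, S `<=` D j) ->
  (forall y, {ae P y, forall w, ~ (S `|` T) (w 1%N) ->
     exists j, ((pf G (w 1%N))%:E <= cont T (D j) (w 1%N))%E}) ->
  (cont T (D i) x <= cont T S x)%E.
Proof.
move=> mT mD mS SD rat.
apply: (@continuation_value_le R X (disc G) (ph G) (reward T) _ _ _ _ _ P hP
  (fun x => pf G x + pg G x + ph G x) _ _ _ _ _ _
  (fun j => D j `|` T) (S `|` T) _ _ _ _ _ x i) => //.
- exact: mreward.
- by move=> y; rewrite lerDr addr_ge0.
- by move=> y; apply: le_trans (reward_le_pg _ _) _; rewrite -addrA addrCA lerDl addr_ge0.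
- by do 2 apply: measurable_funD => //.
- by case: hG.
- by move=> j; exact: measurableU.
- exact: measurableU.
- by move=> j y [/SD|]; [left|right].
- move=> y nST; rewrite /reward memNset; last by move=> Ty; apply: nST; right.
  by have /andP[] := hfhg y.
- move=> y; apply: (@filterS _ _ (ae_filter_ringOfSetsType (P y)) _ _ _ (rat y)).
  move=> w /[swap] nST /(_ nST)[j fj]; exists j.
  by rewrite /reward memNset// => Tw; apply: nST; right.
Qed.

Lemma cont_ae_eq (mu : {measure set (borel X) -> \bar R}) p T T' S S' x :
  transition_densities P mu p ->
  measurable T -> measurable T' -> measurable S -> measurable S' ->
  {ae mu, forall y, T y <-> T' y} -> {ae mu, forall y, ~ T y -> (S y <-> S' y)} ->
  cont T S x = cont T' S' x.
Proof.
move=> hp mT mT' mS mS' TT' SS'.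
have TSTS : {ae mu, forall y, (T y <-> T' y) /\ ((S `|` T) y <-> (S' `|` T') y)}.
  apply: filterS2 TT' SS' => y TT' SS'; split => //; split => -[Sy|Ty].
  - by have [/TT'|/SS' E] := pselect (T y); [right|left; exact/E].
  - by right; exact/TT'.
  - by have [|/SS' E] := pselect (T y); [right|left; exact/E].
  - by right; exact/TT'.
apply: ge0_ae_eq_integral => //.
- by apply: mgain => //; exact: measurableU.
- by apply: mgain => //; exact: measurableU.
apply: filterS (ae_path hp x TSTS) => w wE _; rewrite /gain.
rewrite (@eq_hitting _ 1 (S `|` T) (S' `|` T')); last first.
  by move=> k k0; have [] := wE k k0.
case: hittingP => // t t0 _ _; rewrite /reward.
have [TE _] := wE t t0; congr (_ * _)%:E; congr (if _ then _ else _).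
by apply/idP/idP => /set_mem /TE /mem_set.
Qed.

Hypothesis hsuper : forall x : X,
  supermartingale (P x) (fun t w => disc G t * pg G (w t)).

Local Notation Y := (fun t (w : path_space X) => disc G t * pg G (w t)).

Lemma discounted_pg_step x n A : natural_filtration n A ->
  (\int[P x]_(w in A) (Y n.+1 w)%:E <= \int[P x]_(w in A) (Y n w)%:E)%E.
Proof.
move=> FA; have mA := natural_filtration_measurable FA.
have [_ intY /(_ n n.+1 (leqnSn n))[Z [_ iZ _ /(_ A FA) <-] ZY]] := hsuper x.
(* A version [Z] of the conditional expectation need not be nonnegative, hence
   the detour through its positive part. *)
rewrite [leLHS]integralE; apply: (@le_trans _ _ (\int[P x]_(w in A) (EFin \o Z)^\+ w)%E).
  rewrite -[leRHS]sube0; apply: leeB => //.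
  by apply: integral_ge0 => w _; exact: funeneg_ge0.
have mZ : measurable_fun A (EFin \o Z).
  by apply: measurable_funTS; exact: measurable_int iZ.
apply: ae_ge0_le_integral => //.
- exact: measurable_funepos.
- by move=> w _; rewrite lee_fin mulr_ge0.
- by apply: measurable_funTS; exact: measurable_discounted.
apply: filterS ZY => w ZY _; rewrite funeposE ge_max !lee_fin ZY/=.
by rewrite mulr_ge0.
Qed.

(** A larger [T] ends the game sooner with payoff [pg], and since the
    discounted [pg] is a supermartingale, sooner is better for the player. *)
Lemma cont_mono T T' S x : measurable T -> measurable T' -> measurable S ->
  T `<=` T' -> (cont T S x <= cont T' S x)%E.
Proof.
move=> mT mT' mS TT'.
pose D := S `|` T; pose D' := S `|` T'.
have mD : measurable D by exact: measurableU.
have mD' : measurable D' by exact: measurableU.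
have DD' : D `<=` D' by move=> y [|/TT']; [left|right].
(* The two payoffs can only differ when [T'] is what ends the enlarged game;
   [B n] is the event that this happens at time [n]. *)
pose B n : set (path_space X) := [set w | hitting_from 1 D' w = Some n] `&` visit T' n.
have FB n : natural_filtration n (B n).
  by apply: natural_filtrationI; [exact: hitting_adapted|exact: visit_adapted].
have mB n : measurable (B n) by exact: natural_filtration_measurable (FB n).
have tB : trivIset setT B.
  by move=> i j _ _ [w [[/= hi _] [/= hj _]]]; move: hj; rewrite hi => -[].
have mU : measurable (\bigcup_n B n) by exact: bigcupT_measurable.
have Bhit n w : B n w -> [/\ (0 < n)%N, forall k, (0 < k < n)%N -> ~ D' (w k) & T' (w n)].
  by case=> /=; case: hittingP => // t t0 _ nD [<-].
rewrite /cont /continuation_value.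
rewrite (ge0_integral_setC (P x) mU (gain0 _ _) (mgain mT mD)).
rewrite (ge0_integral_setC (P x) mU (gain0 _ _) (mgain mT' mD')).
apply: leeD; last first.
  rewrite (eq_integral (gainT T' D'))// => w /set_mem nB; rewrite /gain.
  case: (hittingP 1 D' w) => [t t0 D't nD'|nD']; last first.
    by rewrite hitting_eqNone// => k k0 /DD'; exact: nD'.
  have nT't : ~ T' (w t).
    move=> Tt; apply: nB; exists t => //; split => //=.
    exact: hitting_eqSome.
  have St : S (w t) by case: D't.
  rewrite (@hitting_eqSome _ 1 D w t)//; [|by left|].
    by rewrite /reward !memNset// => /TT'.
  by move=> k kt /DD'; exact: nD'.
rewrite !ge0_integral_bigcup//; last 2 first.
- by apply: measurable_funTS; exact: mgain.
- by apply: measurable_funTS; exact: mgain.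
apply: lee_nneseries => [n _ _|n _]; first exact: integral_ge0.
rewrite [leRHS](eq_integral (fun w => (Y n w)%:E)); last first.
  move=> w /set_mem Bw; have [n0 nD T'n] := Bhit _ _ Bw.
  by case: Bw => /= hit _; rewrite /gain hit add0n /reward mem_set.
have Y0 n' (w : path_space X) : 0 <= Y n' w by rewrite mulr_ge0.
have Yad n' (A : set R) : measurable A -> natural_filtration n' (Y n' @^-1` A).
  by case: (hsuper x) => + _ _; exact.
have Ycv : {ae P x, forall w, (limn_esup (fun n => (Y n w)%:E) <=
    limn_einf (fun n => (Y n w)%:E))%E}.
  apply: (@supermartingale_cvg _ (path_space X) R (P x)
    (fun n => cylinders [set s | (s <= n)%N]) _ _ Y) => //.
  - exact: natural_filtration_incr.
  - exact: natural_filtration_measurable.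
  - by move=> n' A; exact: discounted_pg_step.
  - by rewrite prob_kernel ltry.
apply: (@optional_stopping _ (path_space X) R (P x)
    (fun n => cylinders [set s | (s <= n)%N]) _ _ Y _ _ _ (visit D)) => //.
- exact: natural_filtration_incr.
- exact: natural_filtration_measurable.
- by move=> n' A; exact: discounted_pg_step.
- by move=> n'; exact: visit_adapted.
- exact: FB.
- by apply: measurable_funTS; exact: mgain.
- move=> s w ns Bw [Ds av]; have [n0 nD' _] := Bhit _ _ Bw.
  rewrite /gain (@hitting_eqSome _ 1 D w s)//.
  + by rewrite lee_fin ler_wpM2l.
  + exact: leq_trans ns.
  + move=> k /andP[k0 ks]; have [nk|kn] := leqP n k.
      by apply: av; rewrite nk.
    by move=> /DD'; apply: nD'; rewrite k0.
apply: filterS Ycv => w Ycv Bw nC; apply: le_trans Ycv.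
have [n0 nD' _] := Bhit _ _ Bw.
rewrite /gain hitting_eqNone; last first.
  move=> k k0; have [nk|kn] := leqP n k; first exact: nC.
  by move=> /DD'; apply: nD'; rewrite k0.
apply: le_limn_esup => t; rewrite lee_fin ler_wpM2l//.
by have /andP[] := hfhg (w t).
Qed.

End player.

(** * Least rational policies *)

Section essential_minimum.
Context d (T : measurableType d) (R : realType).
Variable mu : {sigma_finite_measure set T -> \bar R}.

(** Minimise the measure over each piece of a countable cover by sets of finite
    measure, then intersect the minimisers. *)
Lemma essential_minimum (Q : set (set T)) :
  Q `<=` measurable -> Q !=set0 ->
  (forall D : nat -> set T, (forall i, Q (D i)) -> Q (\bigcap_i D i)) ->
  exists2 S, Q S & forall S', Q S' -> {ae mu, forall y, S y -> S' y}.
Proof.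
move=> Qm [S0 QS0] Qcap.
have [F FT Fk] := sigma_finiteT mu.
have mF k : measurable (F k) by case: (Fk k).
have minimiser k : exists S, Q S /\
    forall S', Q S' -> (mu (S `&` F k) <= mu (S' `&` F k))%E.
  pose v := ereal_inf [set mu (S `&` F k) | S in Q].
  have v0 : (0 <= v)%E by apply: le_ereal_inf_tmp => _ [S _ <-].
  have vfin : v \is a fin_num.
    rewrite ge0_fin_numE//; apply: le_lt_trans (Fk k).2.
    apply: (@le_trans _ _ (mu (S0 `&` F k))).
      by apply: ereal_inf_lbound; exists S0.
    apply: le_measure; rewrite ?inE//; apply: measurableI => //; exact: Qm.
  have /choice[D HD] (n : nat) : exists S, Q S /\
      (mu (S `&` F k) < v + n.+1%:R^-1%:E)%E.
    have : (v < v + n.+1%:R^-1%:E)%E by rewrite lteDl// lte_fin invr_gt0.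
    by move=> /ereal_inf_lt[_ [S QS <-] lt]; exists S.
  exists (\bigcap_i D i); split; first by apply: Qcap => i; case: (HD i).
  move=> S' QS'; apply: (@le_trans _ _ v); last by apply: ereal_inf_lbound; exists S'.
  apply/lee_addgt0Pr => e e0.
  have [n ne] : exists n : nat, n.+1%:R^-1 < e.
    by have [n _ /(_ n (leqnn n))] := near_infty_natSinv_lt (PosNum e0); exists n.
  apply: (@le_trans _ _ (mu (D n `&` F k))).
    apply: le_measure; rewrite ?inE.
    - apply: measurableI => //; apply: bigcapT_measurable => i.
      by apply: Qm; case: (HD i).
    - by apply: measurableI => //; apply: Qm; case: (HD n).
    - by move=> y [Dy Fy]; split => //; exact: Dy.
  by apply: le_trans (ltW (HD n).2) _; rewrite leeD2l// lee_fin ltW.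
have /choice[M HM] := minimiser.
exists (\bigcap_k M k); first by apply: Qcap => k; case: (HM k).
move=> S' QS'; set S := \bigcap_k M k.
have QS : Q S by apply: Qcap => k; case: (HM k).
have mS : measurable S by exact: Qm.
have mS' : measurable S' by exact: Qm.
have QI : Q (S `&` S').
  rewrite (_ : S `&` S' = \bigcap_i (if i is 0%N then S else S')).
    by apply: Qcap => -[|i].
  apply/seteqP; split => [y [Sy S'y] [|i] _ //|y h].
  by split; [exact: (h 0%N)|exact: (h 1%N)].
suff neg k : mu.-negligible ((S `\` S') `&` F k).
  apply: negligibleS (negligible_bigcup neg) => y /= h.
  have [k _ Fy] : (\bigcup_k F k) y by rewrite -FT.
  exists k => //; split => //; split; last by move=> S'y; apply: h.
  by apply: contrapT => nS; apply: h.
have mk : measurable ((S `\` S') `&` F k) by apply: measurableI => //; exact: measurableD.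
exists ((S `\` S') `&` F k); split => //.
have mI : measurable ((S `&` S') `&` F k) by do 2 apply: measurableI => //.
have le1 : (mu (S `&` F k) <= mu ((S `&` S') `&` F k))%E.
  apply: le_trans ((HM k).2 _ QI); apply: le_measure; rewrite ?inE.
  - exact: measurableI.
  - by apply: measurableI => //; apply: Qm; case: (HM k).
  - by move=> y [Sy Fy]; split => //; exact: Sy.
have Ifin : (mu ((S `&` S') `&` F k) < +oo)%E.
  apply: le_lt_trans (Fk k).2; apply: le_measure; rewrite ?inE//.
have E : mu (S `&` F k) = (mu ((S `&` S') `&` F k) + mu ((S `\` S') `&` F k))%E.
  rewrite -measureU//; last by apply/seteqP; split => // y [[[_ ?] _] [[_]]].
  congr (mu _); apply/seteqP; split => [y [Sy Fy]|y [[[Sy _] Fy]|[[Sy _] Fy]]] //.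
  by have [S'y|nS'y] := pselect (S' y); [left|right].
apply/eqP; rewrite eq_le measure_ge0 andbT.
by move: le1; rewrite E -[leRHS]adde0 leeD2lE// ge0_fin_numE.
Qed.

End essential_minimum.

Section rational_policies.
Variables (R : realType) (X : ptopologicalType).
Variables (P : R.-pker borel X ~> path_space X).
Variables (mu : {sigma_finite_measure set (borel X) -> \bar R}) (p : nat -> X -> X -> R).
Hypothesis hP : strong_markov P.
Hypothesis hp : transition_densities P mu p.
Variable G : player_data R X.
Hypothesis hG : admissible P G.
Hypothesis hfhg : forall x, pf G x <= ph G x <= pg G x.
Implicit Types (S T : set (borel X)) (x : X).

(** Half of the equilibrium condition: waiting is rational wherever the policy
    waits. Unlike equilibria, these policies are stable under intersection. *)
Definition rational T : set (set (borel X)) :=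
  [set S | measurable S /\
    {ae mu, forall y, ~ S y -> ~ T y -> ((pf G y)%:E <= cont P G T S y)%E}].

Definition least_rational T S :=
  rational T S /\ forall S', rational T S' -> {ae mu, forall y, S y -> S' y}.

Lemma rationalT T : rational T setT.
Proof. by split => //; apply: aeW => y /(_ I). Qed.

(** Where the intersection waits, some member waits, and rationally so. *)
Lemma rational_cont_le T (D : nat -> set (borel X)) i x : measurable T ->
  (forall j, rational T (D j)) -> (cont P G T (D i) x <= cont P G T (\bigcap_j D j) x)%E.
Proof.
move=> mT rD; apply: cont_le => //.
- by move=> j; case: (rD j).
- by apply: bigcapT_measurable => j; case: (rD j).
- by move=> j y; exact.
move=> y; have := ae_path hp y (ae_foralln (fun j => (rD j).2)).
apply: filterS => w wD nST.
have [j nDj] : exists j, ~ D j (w 1%N).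
  by apply: contrapT => h; apply: nST; left => j _; apply: contrapT => nDj; apply: h; exists j.
by exists j; apply: wD => // Tw; apply: nST; right.
Qed.

Lemma rational_bigcap T (D : nat -> set (borel X)) : measurable T ->
  (forall j, rational T (D j)) -> rational T (\bigcap_j D j).
Proof.
move=> mT rD; split; first by apply: bigcapT_measurable => j; case: (rD j).
have := ae_foralln (fun j => (rD j).2); apply: filterS => y yD nD nT.
have [j nDj] : exists j, ~ D j y.
  by apply: contrapT => h; apply: nD => j _; apply: contrapT => nDj; apply: h; exists j.
exact: le_trans (yD j nDj nT) (rational_cont_le j y mT rD).
Qed.

Lemma least_rational_exists T : measurable T -> exists S, least_rational T S.
Proof.
move=> mT; have [S rS lS] := @essential_minimum _ _ _ mu (rational T)
  (fun S rS => rS.1) (ex_intro _ _ (rationalT T)) (fun D => @rational_bigcap T D mT).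
by exists S.
Qed.

Lemma rational_setI T S S' : measurable T -> rational T S -> rational T S' ->
  rational T (S `&` S').
Proof.
move=> mT rS rS'.
rewrite (_ : S `&` S' = \bigcap_i (if i is 0%N then S else S')).
  by apply: rational_bigcap => // -[|i].
apply/seteqP; split => [y [Sy S'y] [|i] _ //|y h].
by split; [exact: (h 0%N)|exact: (h 1%N)].
Qed.

(** Up to a null set [S] is [S' `&` S], whose value is at least that of [S']. *)
Lemma least_rational_cont_ge T S S' x : measurable T -> least_rational T S ->
  rational T S' -> (cont P G T S' x <= cont P G T S x)%E.
Proof.
move=> mT [rS lS] rS'.
pose D (i : nat) := if i is 0%N then S' else S.
have DI : \bigcap_i D i = S' `&` S.
  apply/seteqP; split => [y h|y [S'y Sy] [|i] _ //].
  by split; [exact: (h 0%N)|exact: (h 1%N)].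
have rD j : rational T (D j) by case: j.
apply: le_trans (rational_cont_le 0 x mT rD) _; rewrite DI.
rewrite (@cont_ae_eq R X P G hG mu p T T (S' `&` S) S x)//.
- by apply: measurableI; [exact: rS'.1|exact: rS.1].
- exact: rS.1.
- exact: aeW.
by have := lS _ rS'; apply: filterS => y yS _; split => [[]|] // Sy; split => //; exact: yS.
Qed.

(** Ceasing to stop at points where waiting is at least as good only makes
    waiting more valuable elsewhere. *)
Lemma rational_remove T S S' : measurable T -> rational T S -> measurable S' ->
  S' `<=` S ->
  {ae mu, forall y, S y -> ~ S' y -> ~ T y -> ((pf G y)%:E <= cont P G T S y)%E} ->
  rational T S'.
Proof.
move=> mT [mS rS] mS' S'S rem; split => //.
have le x : (cont P G T S x <= cont P G T S' x)%E.
  apply: (@cont_le R X P G hP hG hfhg T (fun=> S) S' x 0) => //.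
  move=> y; apply: (@filterS _ _ (ae_filter_ringOfSetsType (P y)) _ _ _
    (ae_path hp y (filterI rS rem))) => w /(_ 1%N isT)[wS wrem] nST; exists 0%N.
  have nT : ~ T (w 1%N) by move=> Tw; apply: nST; right.
  have nS' : ~ S' (w 1%N) by move=> Sw; apply: nST; left.
  by have [Sw|nS] := pselect (S (w 1%N)); [exact: wrem|exact: wS].
apply: filterS2 rS rem => y yS yrem nS'y nTy.
apply: le_trans (le y).
by have [Sy|nSy] := pselect (S y); [exact: yrem|exact: yS].
Qed.

(** Points of [T], and points where stopping is not strictly better than
    waiting, could be removed from [S]. *)
Lemma least_rational_stop T S : measurable T -> least_rational T S ->
  {ae mu, forall y, S y -> ~ T y /\ (cont P G T S y < (pf G y)%:E)%E}.
Proof.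
move=> mT [rS lS].
pose S' : set (borel X) := S `&` (~` T `&` [set y | cont P G T S y < (pf G y)%:E]%E).
have mlt : measurable ([set y : borel X | cont P G T S y < (pf G y)%:E]%E).
  rewrite -[[set _ | _]]setTI; apply: measurable_lte => //.
    by apply: measurable_cont => //; exact: rS.1.
  by apply/measurable_EFinP; case: hG => _ [[]].
have mS' : measurable S'.
  apply: measurableI; first exact: rS.1.
  by apply: measurableI => //; exact: measurableC.
have rS' : rational T S'.
  apply: (@rational_remove T S S') => //; first by move=> y [].
  apply: aeW => y Sy nS'y nTy; rewrite leNgt; apply/negP => lt.
  by apply: nS'y; split.
by have := lS _ rS'; apply: filterS => y yS /yS[_ []].
Qed.

Hypothesis hsuper : forall x : X,
  supermartingale (P x) (fun t w => disc G t * pg G (w t)).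

Lemma rational_mono T T' S : measurable T -> measurable T' ->
  {ae mu, forall y, T y -> T' y} -> rational T S -> rational T' S.
Proof.
move=> mT mT' TT' [mS rS]; split => //.
apply: filterS2 (TT') rS => y yT yS nSy nT'y.
have nTy : ~ T y by move=> /yT.
apply: le_trans (yS nSy nTy) _.
rewrite (@cont_ae_eq R X P G hG mu p T (T `&` T') S S y)//.
- by apply: cont_mono => //; exact: measurableI.
- exact: measurableI.
- by move: TT'; apply: filterS => z zT; split => [Tz|[]//]; split => //; exact: zT.
- exact: aeW.
Qed.

End rational_policies.

(** * Intra-personal equilibria in terms of continuation values *)

Section equilibrium_criterion.
Variables (R : realType) (X : ptopologicalType).
Variables (P : R.-pker borel X ~> path_space X) (G : player_data R X).
Hypothesis hX : polish_space R X.
Hypothesis hP : strong_markov P.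
Hypothesis hG : admissible P G.
Hypothesis hfhg : forall x, pf G x <= ph G x <= pg G x.
Implicit Types (S T : set (borel X)) (x : X).

Let mf : measurable_fun setT (pf G : borel X -> R). Proof. by case: hG => _ [[]]. Qed.
Let mg : measurable_fun setT (pg G : borel X -> R). Proof. by case: hG => _ [_ []]. Qed.
Let mh : measurable_fun setT (ph G : borel X -> R). Proof. by case: hG => _ [_ _ []]. Qed.

(** Singletons are closed in a metrizable space; their measurability turns
    [P x [set w | w 0 = x] = 1] into an almost sure statement. *)
Lemma polish_measurable_set1 x : measurable ([set x] : set (borel X)).
Proof.
case: hX => _ [dist [d0 dC dT dnbhs _]].
rewrite -[[set x]]setCK; apply: measurableC; apply: sub_gen_smallest.
rewrite openE => y /= xy; apply/dnbhs.
have dge a b : 0 <= dist a b.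
  have := dT a b a; rewrite (dC b a) (d0 a a).2// -mulr2n => h.
  by rewrite -(pmulrn_lge0 _ (ltn0Sn 1)).
exists (dist y x); last by move=> z /= lt zx; move: lt; rewrite zx ltxx.
by rewrite lt_neqAle dge andbT eq_sym; apply/eqP => /d0 yx; apply: xy.
Qed.

Lemma ae_start x : {ae P x, forall w : path_space X, w 0%N = x}.
Proof.
have mV : measurable (visit [set x] 0).
  apply: natural_filtration_measurable; apply: visit_adapted.
  exact: polish_measurable_set1.
have Px : P x (visit [set x] 0) = 1%E by case: hP => /(_ x).
exists (~` visit [set x] 0); split => //; first exact: measurableC.
pose q := P x (~` visit [set x] 0).
have E : (1 = P x (visit [set x] 0) + q)%E.
  rewrite /q -measureU//; [|exact: measurableC|exact: setICr].
  by rewrite setUv; exact/esym/prob_kernel.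
have {}E : (1 = 1 + q)%E := etrans E (congr1 (fun z => z + q)%E Px).
suff : q = 0%E by [].
have <- : (q + 1 - 1)%E = q by rewrite addeK.
by rewrite [X in (X - _)%E]addeC -E -EFinD subrr.
Qed.

Lemma expectation_ae_cst x (F : path_space X -> \bar R) (c : R) : 0 <= c ->
  measurable_fun setT F -> (forall w, w 0%N = x -> F w = c%:E) ->
  (\int[P x]_w F w = c%:E)%E.
Proof.
move=> c0 mF Fc; rewrite (@ae_eq_integral _ _ _ _ _ (cst c%:E) F)//.
  by rewrite integral_cst// prob_kernel mule1.
apply: (@filterS _ _ (ae_filter_ringOfSetsType (P x)) _ _ _ (ae_start x)) => w wx _.
exact: Fc.
Qed.

Definition payoff_at (o1 o2 : option nat) (w : path_space X) : \bar R :=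
  payoff G (fun=> o1) (fun=> o2) w.

Lemma measurable_payoff_at o1 o2 : measurable_fun setT (payoff_at o1 o2).
Proof.
rewrite /payoff_at /payoff /=; case: o1 o2 => [t|] [s|] /=.
- by case: (t < s)%N; [|case: (s < t)%N]; exact: measurable_discounted.
- exact: measurable_discounted.
- exact: measurable_discounted.
- by apply: measurable_fun_limn_esup => t; exact: measurable_discounted.
Qed.

Lemma measurable_payoff_rho_plus S T : measurable S -> measurable T ->
  measurable_fun setT (payoff G (rho_plus S) (rho T)).
Proof.
move=> mS mT; apply: (@measurable_at_hitting R X 1 S
  (fun o w => payoff_at o (hitting_from 0 T w) w)) => // o.
apply: (@measurable_at_hitting R X 0 T (fun o' w => payoff_at o o' w)) => // o'.
exact: measurable_payoff_at.
Qed.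

Lemma measurable_payoff_time0 T : measurable T ->
  measurable_fun setT (payoff G time0 (rho T)).
Proof.
move=> mT; apply: (@measurable_at_hitting R X 0 T
  (fun o' w => payoff_at (Some 0%N) o' w)) => // o'.
exact: measurable_payoff_at.
Qed.

Let d0 : disc G 0 = 1. Proof. by case: hG => [[]]. Qed.

Lemma rho_in T w : T (w 0%N) -> rho T w = Some 0%N.
Proof. by move=> Tw; rewrite /rho (@hitting_eqSome _ 0 T w 0). Qed.

Lemma rho_out T w : ~ T (w 0%N) -> rho T w = hitting_from 1 T w.
Proof.
move=> nTw; rewrite /rho; case: (hittingP 1 T w) => [t t0 Tt nT|nT].
  by apply: hitting_eqSome => // -[//|k] /andP[_ kt]; apply: nT.
by apply: hitting_eqNone => -[//|k] _; exact: nT.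
Qed.

Lemma J_stop_in T x : measurable T -> T x -> J P G x time0 (rho T) = (ph G x)%:E.
Proof.
move=> mT Tx; apply: expectation_ae_cst; first by case: hG => _ [_ _ []].
  exact: measurable_payoff_time0.
by move=> w wx; rewrite /payoff rho_in ?wx//= d0 mul1r wx.
Qed.

Lemma J_stop_out T x : measurable T -> ~ T x -> J P G x time0 (rho T) = (pf G x)%:E.
Proof.
move=> mT nTx; apply: expectation_ae_cst; first by case: hG => _ [[]].
  exact: measurable_payoff_time0.
move=> w wx; rewrite /payoff rho_out ?wx//=.
by case: hittingP => [t t0 _ _|_]; rewrite ?t0 d0 mul1r wx.
Qed.

Lemma J_continue_in S T x : measurable S -> measurable T -> T x ->
  J P G x (rho_plus S) (rho T) = (pg G x)%:E.
Proof.
move=> mS mT Tx; apply: expectation_ae_cst; first by case: hG => _ [_ []].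
  exact: measurable_payoff_rho_plus.
move=> w wx; rewrite /payoff rho_in ?wx//= /rho_plus.
by case: hittingP => [t t0 _ _|_]; rewrite ?ltn0 ?t0 d0 mul1r.
Qed.

Lemma J_continue_out S T x : measurable S -> measurable T -> ~ T x ->
  (forall y, S y -> T y -> ph G y = pg G y) ->
  J P G x (rho_plus S) (rho T) = cont P G T S x.
Proof.
move=> mS mT nTx hg.
have mST : measurable (S `|` T) by exact: measurableU.
apply: ae_eq_integral => //.
- exact: measurable_payoff_rho_plus.
- apply: measurable_gain => //; apply: measurable_fun_ifT => //.
  by apply: (measurable_fun_bool true); rewrite setTI preimage_mem_true.
apply: (@filterS _ _ (ae_filter_ringOfSetsType (P x)) _ _ _ (ae_start x)) => w wx _.
rewrite /payoff rho_out ?wx// /rho_plus /gain.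
case: (hittingP 1 (S `|` T) w) => [t t0 STt nST|nST]; last first.
  rewrite !hitting_eqNone//; first by move=> k k0 Tk; apply: (nST k) => //; right.
  by move=> k k0 Sk; apply: (nST k) => //; left.
have nS k : (0 < k < t)%N -> ~ S (w k) by move=> kt Sk; apply: (nST k) => //; left.
have nT k : (0 < k < t)%N -> ~ T (w k) by move=> kt Tk; apply: (nST k) => //; right.
rewrite add0n /reward; have [Tt|nTt] := pselect (T (w t)).
  rewrite (mem_set Tt) (@hitting_eqSome _ 1 T w t)//.
  case: hittingP => // s s0 Ss _.
  have [st|ts|st] := ltngtP s t; [|by []|].
    by case: (nS s _ Ss); rewrite s0.
  by rewrite -st hg// st.
have St : S (w t) by case: STt.
rewrite memNset// (@hitting_eqSome _ 1 S w t)//.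
case: hittingP => // s s0 Ts _.
have [//|st|st] := ltngtP t s; last by case: nTt; rewrite st.
by case: (nT s _ Ts); rewrite s0.
Qed.

(** On [T] the alternatives are [ph] for stopping and [pg] for waiting. *)
Lemma intra_equilibrium_simultaneous S T : measurable T ->
  intra_equilibria P G T S -> forall y, S y -> T y -> ph G y = pg G y.
Proof.
move=> mT [mS ES] y Sy Ty; have : Theta P G T S y by rewrite ES.
case=> -[] // _; rewrite J_stop_in// J_continue_in// lee_fin => gh.
by apply/eqP; rewrite eq_le gh andbT; have /andP[] := hfhg y.
Qed.

Lemma intra_equilibrium_wait S T : measurable T ->
  intra_equilibria P G T S ->
  forall y, ~ S y -> ~ T y -> ((pf G y)%:E <= cont P G T S y)%E.
Proof.
move=> mT eS y nSy nTy; have hg := intra_equilibrium_simultaneous mT eS.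
case: eS => mS ES; rewrite leNgt; apply/negP => lt; apply: nSy; rewrite -ES.
have [Sy|nSy] := pselect (S y); [left|right]; split=> //;
  rewrite J_stop_out// J_continue_out//.
exact: ltW.
Qed.

Lemma intra_equilibriumP S T : measurable S -> measurable T ->
  (forall y, S y -> ~ T y) ->
  (forall y, S y -> (cont P G T S y <= (pf G y)%:E)%E) ->
  (forall y, ~ S y -> ~ T y -> ((pf G y)%:E <= cont P G T S y)%E) ->
  intra_equilibria P G T S.
Proof.
move=> mS mT ST stop wait; split => //; apply/seteqP; split => y.
  case=> [[]//|[nSy]]; have [Ty|nTy] := pselect (T y).
    rewrite J_stop_in// J_continue_in// lte_fin ltNge.
    by have /andP[_ ->] := hfhg y.
  rewrite J_stop_out// J_continue_out//; last by move=> z /ST.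
  by rewrite ltNge wait.
move=> Sy; left; split => //; rewrite J_stop_out//; last exact: ST.
rewrite J_continue_out//; [exact: stop|exact: ST|by move=> z /ST].
Qed.

Lemma equilibrium_value_le S S' T x : measurable T ->
  intra_equilibria P G T S -> intra_equilibria P G T S' ->
  (cont P G T S' x <= cont P G T S x)%E ->
  (equilibrium_value P G T x S' <= equilibrium_value P G T x S)%E.
Proof.
move=> mT eS eS' le; rewrite /equilibrium_value.
have [mS _] := eS; have [mS' _] := eS'.
have [Tx|nTx] := pselect (T x); first by rewrite !J_continue_in.
rewrite !J_continue_out//; try exact: intra_equilibrium_simultaneous.
by rewrite ge_max !le_max lexx le orbT.
Qed.

End equilibrium_criterion.

(** * Existence of a sharp inter-personal equilibrium *)

Section existence.
Variables (R : realType) (X : ptopologicalType).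
Variables (P : R.-pker borel X ~> path_space X).
Variables (mu : {sigma_finite_measure set (borel X) -> \bar R}) (p : nat -> X -> X -> R).
Hypothesis hX : polish_space R X.
Hypothesis hP : strong_markov P.
Hypothesis hp : transition_densities P mu p.

(** Passing to [T] and [S], which differ from [T0] and [S0] by null sets, affects
    neither rationality nor any continuation value. *)
Lemma optimal_of_least_rational (G : player_data R X) (T T0 S S0 : set (borel X)) :
  admissible P G -> (forall x, pf G x <= ph G x <= pg G x) ->
  (forall x : X, supermartingale (P x) (fun t w => disc G t * pg G (w t))) ->
  measurable T -> measurable T0 ->
  {ae mu, forall y, T y <-> T0 y} -> {ae mu, forall y, S y <-> S0 y} ->
  least_rational P mu G T0 S0 -> intra_equilibria P G T S ->
  optimal_equilibria P G T S.
Proof.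
move=> hG hfhg hsuper mT mT0 TT0 SS0 lS eS; split => // S' eS' x.
have [[mS0 _] _] := lS; have [mS _] := eS; have [mS' _] := eS'.
apply: equilibrium_value_le => //.
rewrite (@cont_ae_eq R X P G hG mu p T T0 S' S')//; last exact: aeW.
rewrite (@cont_ae_eq R X P G hG mu p T T0 S S0)//; last first.
  by move: SS0; apply: filterS.
apply: (@least_rational_cont_ge R X P mu p hP hp G hG hfhg T0 S0 S') => //.
apply: (@rational_mono R X P mu p hp G hG hfhg hsuper T T0 S') => //.
  by move: TT0; apply: filterS => y [].
by split => //; apply: aeW; exact: (intra_equilibrium_wait hX hP hG hfhg).
Qed.

Variables G1 G2 : player_data R X.
Hypotheses (hG1 : admissible P G1) (hG2 : admissible P G2).
Hypothesis hfhg1 : forall x, pf G1 x <= ph G1 x <= pg G1 x.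
Hypothesis hfhg2 : forall x, pf G2 x <= ph G2 x <= pg G2 x.
Hypothesis hsuper1 : forall x : X,
  supermartingale (P x) (fun t w => disc G1 t * pg G1 (w t)).
Hypothesis hsuper2 : forall x : X,
  supermartingale (P x) (fun t w => disc G2 t * pg G2 (w t)).

(** Tarski's argument. With [B S] a least rational answer of the second player
    to [S], take the least [S] among those rational for the first player against
    [B S]. If [S'] is rational against the same [B S], then [S `&` S'] faces the
    larger policy [B (S `&` S')], against which it is still rational, so [S] lies
    in [S `&` S']. *)
Lemma mutual_least_rational : exists S T,
  least_rational P mu G1 T S /\ least_rational P mu G2 S T.
Proof.
have /choice[B HB] (S : set (borel X)) : exists T, measurable S ->
    least_rational P mu G2 S T.
  have [mS|nmS] := pselect (measurable S); last by exists set0.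
  have [T lT] := @least_rational_exists R X P mu p hP hp G2 hG2 hfhg2 S mS.
  by exists T.
have mB S : measurable S -> measurable (B S) by move=> /HB[[]].
have Banti S S' : measurable S -> measurable S' -> S `<=` S' ->
    {ae mu, forall y, B S' y -> B S y}.
  move=> mS mS' SS'; apply: (HB S' mS').2.
  apply: (@rational_mono R X P mu p hp G2 hG2 hfhg2 hsuper2 S S') => //.
    by apply: aeW => y; exact: SS'.
  by case: (HB S mS).
pose Q : set (set (borel X)) := [set S | rational P mu G1 (B S) S].
have Qanti S S' : measurable S -> measurable S' -> S `<=` S' ->
    rational P mu G1 (B S') `<=` rational P mu G1 (B S).
  move=> mS mS' SS' D; apply: (@rational_mono R X P mu p hp G1 hG1 hfhg1 hsuper1) => //.
  - exact: mB.
  - exact: mB.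
  - exact: Banti.
have [S QS lS] : exists2 S, Q S & forall S', Q S' -> {ae mu, forall y, S y -> S' y}.
  apply: essential_minimum; first by move=> S [].
    by exists setT; exact: rationalT.
  move=> D QD; have mD i : measurable (D i) by case: (QD i).
  have mcap : measurable (\bigcap_i D i) by exact: bigcapT_measurable.
  apply: (@rational_bigcap R X P mu p hP hp G1 hG1 hfhg1); first exact: mB.
  by move=> j; apply: (Qanti _ (D j)) => //; [by move=> y /(_ j I)|exact: QD].
have mS : measurable S by case: QS.
exists S, (B S); split; last exact: HB.
split => // S' rS'; have mS' : measurable S' by case: rS'.
have mI : measurable (S `&` S') by exact: measurableI.
have QI : Q (S `&` S').
  apply: (Qanti _ S) => //.
  by apply: (@rational_setI R X P mu p hP hp G1 hG1 hfhg1) => //; exact: mB.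
by have := lS _ QI; apply: filterS => y yS /yS[].
Qed.

(** Off a null set the mutually least policies already satisfy the equilibrium
    inequalities. On that null set, which the process never visits after time
    0, membership can be decided by the inequalities themselves. *)
Lemma sharp_equilibrium_exists : sharp_equilibria P G1 G2 !=set0.
Proof.
have [S0 [T0 [lS lT]]] := mutual_least_rational.
have [[mS0 wait1] _] := lS; have [[mT0 wait2] _] := lT.
have stop1 := @least_rational_stop R X P mu p hP hp G1 hG1 hfhg1 T0 S0 mT0 lS.
have stop2 := @least_rational_stop R X P mu p hP hp G2 hG2 hfhg2 S0 T0 mS0 lT.
pose c1 := cont P G1 T0 S0; pose c2 := cont P G2 S0 T0.
have [N [mN N0 NP]] := filterI (filterI stop1 stop2) (filterI wait1 wait2).
have good y : ~ N y ->
    [/\ S0 y -> ~ T0 y /\ (c1 y < (pf G1 y)%:E)%E,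
        T0 y -> ~ S0 y /\ (c2 y < (pf G2 y)%:E)%E,
        ~ S0 y -> ~ T0 y -> ((pf G1 y)%:E <= c1 y)%E
      & ~ T0 y -> ~ S0 y -> ((pf G2 y)%:E <= c2 y)%E].
  by move=> nN; have [[? ?] [? ?]] := contrapT (fun h => nN (NP y h)).
pose L1 : set (borel X) := [set y | c1 y < (pf G1 y)%:E]%E.
pose L2 : set (borel X) := [set y | c2 y < (pf G2 y)%:E]%E.
have mL1 : measurable L1.
  rewrite -[L1]setTI; apply: measurable_lte => //; first exact: measurable_cont.
  by apply/measurable_EFinP; case: hG1 => _ [[]].
have mL2 : measurable L2.
  rewrite -[L2]setTI; apply: measurable_lte => //; first exact: measurable_cont.
  by apply/measurable_EFinP; case: hG2 => _ [[]].
pose S := (S0 `\` N) `|` (N `&` L1).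
pose T := (T0 `\` N) `|` (N `&` (L2 `\` L1)).
have mS : measurable S.
  by apply: measurableU; [exact: measurableD|exact: measurableI].
have mT : measurable T.
  apply: measurableU; first exact: measurableD.
  by apply: measurableI => //; exact: measurableD.
have aeN : {ae mu, forall y, ~ N y}.
  by exists N; split => // y /= /contrapT.
have aeS : {ae mu, forall y, S y <-> S0 y}.
  move: aeN; apply: filterS => y nN; split => [[[]|[]]//|Sy].
  by left; split.
have aeT : {ae mu, forall y, T y <-> T0 y}.
  move: aeN; apply: filterS => y nN; split => [[[]|[]]//|Ty].
  by left; split.
have E1 x : cont P G1 T S x = c1 x.
  by apply: (@cont_ae_eq R X P G1 hG1 mu p) => //; move: aeS; apply: filterS.
have E2 x : cont P G2 S T x = c2 x.
  by apply: (@cont_ae_eq R X P G2 hG2 mu p) => //; move: aeT; apply: filterS.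
have in1 y : S y -> ~ T y /\ (c1 y < (pf G1 y)%:E)%E.
  case=> [[Sy nN]|[Ny Ly]].
    have [/(_ Sy)[nTy lt] _ _ _] := good y nN.
    by split => // -[[]|[]].
  by split => // -[[_ /(_ Ny)]|[_ [_ /(_ Ly)]]].
have in2 y : T y -> ~ S y /\ (c2 y < (pf G2 y)%:E)%E.
  move=> Ty; split; first by move=> /in1[].
  case: Ty => [[Ty nN]|[_ []]//].
  by have [_ stop _ _] := good y nN; case: (stop Ty).
have out y : ~ S y -> ~ T y ->
    ((pf G1 y)%:E <= c1 y)%E /\ ((pf G2 y)%:E <= c2 y)%E.
  move=> nSy nTy; have [Ny|nN] := pselect (N y).
    have nL1 : ~ L1 y by move=> Ly; apply: nSy; right.
    have nL2 : ~ L2 y by move=> Ly; apply: nTy; right.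
    by split; rewrite leNgt; apply/negP.
  have nS0 : ~ S0 y by move=> Sy; apply: nSy; left.
  have nT0 : ~ T0 y by move=> Ty; apply: nTy; left.
  by have [_ _ h1 h2] := good y nN; split; [exact: h1|exact: h2].
have eS : intra_equilibria P G1 T S.
  apply: (intra_equilibriumP hX hP hG1 hfhg1) => //.
  - by move=> y /in1[].
  - by move=> y /in1[_ lt]; rewrite E1 ltW.
  - by move=> y nS nT; rewrite E1; case: (out y nS nT).
have eT : intra_equilibria P G2 S T.
  apply: (intra_equilibriumP hX hP hG2 hfhg2) => //.
  - by move=> y /in2[].
  - by move=> y /in2[_ lt]; rewrite E2 ltW.
  - by move=> y nT nS; rewrite E2; case: (out y nS nT).
exists (S, T); split => //=.
  exact: (@optimal_of_least_rational G1 T T0 S S0).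
exact: (@optimal_of_least_rational G2 S S0 T T0).
Qed.

End existence.

Theorem theorem4p2 (R : realType) (X : ptopologicalType)
  (P : R.-pker borel X ~> path_space X)
  (mu : {sigma_finite_measure set (borel X) -> \bar R})
  (p : nat -> X -> X -> R)
  (G : 'I_2 -> player_data R X)
  (hX : polish_space R X)
  (hP : strong_markov P)
  (hG : forall i, admissible P (G i))
  (hp : transition_densities P mu p)
  (hfhg : forall i x, pf (G i) x <= ph (G i) x <= pg (G i) x)
  (hsuper : forall i (x : X),
     supermartingale (P x) (fun t w => disc (G i) t * pg (G i) (w t))) :
  sharp_equilibria P (G ord0) (G ord_max) !=set0.
Proof.
exact: (sharp_equilibrium_exists hX hP hp (hG ord0) (hG ord_max)
  (hfhg ord0) (hfhg ord_max) (hsuper ord0) (hsuper ord_max)).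
Qed.
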